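(* Let $K$ be a number field, let $n\ge 1$ and $s\ge 2$ be integers and let $c>0$. There is a constant $C>0$ depending only on $K$, $n$, $s$ and $c$ such that the following holds for every real $H\ge 2$. Let $A_1,\ldots,A_s\in\mathrm{GL}_n(K)$ be pairwise commuting, diagonalizable matrices with $\mathcal{H}(A_i)\le cH$ for $i\in\{1,\ldots,s\}$, and assume that there are integers $k_1,\ldots,k_s$ with $k_1\cdots k_s\ne 0$ such that $$A_1^{k_1}\cdots A_s^{k_s}=I_n.$$ Then there are a positive integer $R<s$ and integers $k_1,\ldots,k_s$ with $k_1\cdots k_s\neq 0$ and $|k_1|,\ldots,|k_s|\le C(\log H)^R$ such that $A_1^{k_1}\cdots A_s^{k_s}=I_n$ holds.
   Context: For a matrix $A=(a_{ij})$ with algebraic entries, $\mathcal{H}(A)$ denotes the (absolute) multiplicative Weil height of $A$ viewed as a point of projective space via $(1:a_{11}:a_{12}:\cdots:a_{nn})$. ''Diagonalizable'' means diagonalizable over an algebraic closure of $K$. $I_n$ is the $n\times n$ identity matrix. *)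

(* Defs.v *)
From HB Require Import structures.
From mathcomp Require Import all_boot all_order all_algebra all_field finmap.
From mathcomp Require Import all_classical all_reals exp complex.

Set Implicit Arguments.
Unset Strict Implicit.
Unset Printing Implicit Defensive.

Import Order.TTheory GRing.Theory Num.Theory.

Local Open Scope classical_set_scope.
Local Open Scope ring_scope.

(* The finite places of a number field K are represented by the normalized
   (surjective) discrete valuations v : K^* -> Z.  As v is a total function on
   K, its value at 0 is a dummy; it is fixed to 0 so that distinct functions
   stand for distinct places. *)
Definition finite_place (K : fieldExtType rat) : set (K -> int) :=
  [set v | [/\ v 0 = 0,
     forall x y : K, x != 0 -> y != 0 -> v (x * y) = v x + v y,
     forall x y : K, x != 0 -> y != 0 -> x + y != 0 ->
       Num.min (v x) (v y) <= v (x + y) &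
     forall z : int, exists2 x : K, x != 0 & v x = z]].

Definition valuation_ring (K : fieldExtType rat) (v : K -> int) : set K :=
  [set x | x = 0 \/ 0 <= v x].

Definition valuation_ideal (K : fieldExtType rat) (v : K -> int) : set K :=
  [set x | x = 0 \/ 0 < v x].

(* The residue field is viewed as the set of the cosets x + m_v, x in O_v; it
   is finite for v a finite place (fset_set of an infinite set is fset0). *)
Definition residue_card (K : fieldExtType rat) (v : K -> int) : nat :=
  #|` fset_set [set [set y : K | valuation_ideal v (y - x)]
               | x in valuation_ring v] |.

(* |x|_v ^ d_v = q_v ^ (- v x), where |.|_v extends the usual p-adic absolute
   value of Q, d_v = [K_v : Q_p] and q_v is the residue cardinality. *)
Definition finite_norm (R : realType) (K : fieldExtType rat) (v : K -> int)
    (x : K) : R :=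
  if x == 0 then 0 else (residue_card v)%:R ^ (- v x).

(* A complex place v corresponds to two conjugate embeddings, a real one to a
   single embedding, so that a product over all the embeddings contains the
   contribution of v raised to the power d_v = [K_v : R]. *)
Definition complex_embedding (R : realType) (K : fieldExtType rat) :
    set (K -> R[i]) :=
  range (fun f : {rmorphism K -> R[i]} => f : K -> R[i]).

(* Absolute multiplicative Weil height of the projective point with homogeneous
   coordinates x (not all zero):
     (\prod_v max_j |x_j|_v ^ d_v) ^ (1 / [K : Q]). *)
Definition weil_height (R : realType) (K : fieldExtType rat) (m : nat)
    (x : 'rV[K]_m) : R :=
  ((\big[*%R/1]_(f \in @complex_embedding R K)
      \big[Num.max/0]_(j < m) ComplexField.Normc.normc (f (x 0 j))) *
   (\big[*%R/1]_(v \in @finite_place K)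
      \big[Num.max/0]_(j < m) finite_norm R v (x 0 j)))
  `^ (\dim {:K})%:R^-1.

Definition mx_height (R : realType) (K : fieldExtType rat) (n : nat)
    (A : 'M[K]_n) : R :=
  weil_height R (row_mx (1%:M : 'M_1) (mxvec A)).

(* algC is an algebraic closure of K through any embedding of K into algC. *)
Definition geom_diagonalizable (K : fieldExtType rat) (n : nat)
    (A : 'M[K]_n) : Prop :=
  exists f : {rmorphism K -> algC}, diagonalizable (map_mx f A).

(* Main.v *)
Require Import Defs.
From HB Require Import structures.
From mathcomp Require Import all_boot all_order all_algebra all_field finmap.
From mathcomp Require Import all_classical all_reals exp complex.
From mathcomp Require Import zify ring lra.

Set Implicit Arguments.
Unset Strict Implicit.
Unset Printing Implicit Defensive.

Import Order.TTheory GRing.Theory Num.Theory.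
Local Open Scope classical_set_scope.
Local Open Scope ring_scope.

(** Let [L] be the lattice of relations [k], those with
    [A_1^k_1 ... A_s^k_s = 1].  Among the relations without zero entry take
    [k] of least maximum norm, with largest entry [k m], positive after a
    change of sign.  Dirichlet's theorem gives integers [p] with
    [0 < p m <= Q^(s-1)] and [|p j * k m - p m * k j| <= k m / Q] for all [j].  Put
    [B = A_1^p_1 ... A_s^p_s] and [e j = p j * k m - p m * k j].  As [k] is a
    relation, [B^(k m) = A_1^e_1 ... A_s^e_s], so an eigenvalue of [B] has
    logarithmic height at most the sum of those of eigenvalues of the [A_j],
    divided by [Q].  For [Q] a suitable multiple of [log H] this height is so
    small that all eigenvalues of [B] are roots of unity of bounded order, and
    [B^N = 1] for an [N] depending on [K], [n] and [s] only.  Then [N p] is a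
    relation, and subtracting a multiple of it from [k] contradicts minimality
    unless [k m <= (s+1) N Q^(s-1)] (lemma [small_relation]).  So [R = s - 1]
    always works.

    Heights of eigenvalues enter through two elementary quantities, which
    products and powers respect: a common denominator [E], and a bound on the
    absolute values in all complex embeddings (definition [tame]).  The
    denominator is controlled by the following remark
    ([integral_coef_exp], [integral_of_small_denominator]).  If [D x^k] is
    integral and [delta^k = D], then [delta x'] is integral for each conjugate
    [x'] of [x].  So [D^i c^k] is integral for the coefficient [c] of
    codegree [i] of the characteristic polynomial of [x], and hence is a
    rational integer.  If [D^i < 2^k] this forces [c] to be an integer.  Once
    all eigenvalues of [B] are integral with conjugates of absolute value below
    a bound close to [1], Northcott's finiteness confines a long initial segment of
    their powers to a fixed finite set, and two of these powers coincide
    ([torsion_of_small_exponents]).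

    It remains to extract from the height of a matrix a denominator of its
    entries and bounds on their conjugates.  The archimedean part of the
    product gives the latter.  For the former, let [D] be the least common
    denominator.  For each prime [p] dividing [D] some entry multiplied by
    [D / p] is not integral, so it has negative valuation at some finite place
    [v], which lies over [p]; the residue field has at least [p] elements, so
    [v] contributes at least the [p]-part of [D] to the height
    ([weil_height_denominator]).  The facts about places that this needs are
    proved directly: a non-integral element has a pole at some place
    ([nonintegral_place]), residue fields are finite
    ([residue_set_finite]), and finitely many places lie over a prime
    ([places_over_finite]). *)

(** * Valuation rings from maximal subrings *)

Section Subrings.
Variable F : fieldType.
Implicit Types (B : set F) (x y z : F).

Definition subring_set B :=
  [/\ B 1, forall x y, B x -> B y -> B (x - y) &
      forall x y, B x -> B y -> B (x * y)].

Section Closure.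
Variables (B : set F) (ringB : subring_set B).

Lemma subring1 : B 1. Proof. by case: ringB. Qed.
Lemma subringB x y : B x -> B y -> B (x - y).
Proof. by case: ringB => _ + _; apply. Qed.
Lemma subringM x y : B x -> B y -> B (x * y).
Proof. by case: ringB => _ _; apply. Qed.
Lemma subring0 : B 0.
Proof. by rewrite -(subrr 1); apply: subringB; apply: subring1. Qed.
Lemma subringN x : B x -> B (- x).
Proof. by move=> Bx; rewrite -sub0r; apply: subringB => //; apply: subring0. Qed.
Lemma subringD x y : B x -> B y -> B (x + y).
Proof. by move=> Bx By; rewrite -[y]opprK; apply: subringB => //; apply: subringN. Qed.
Lemma subring_sum (I : Type) (r : seq I) (P : pred I) (E : I -> F) :
  (forall i, P i -> B (E i)) -> B (\sum_(i <- r | P i) E i).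
Proof. by move=> BE; apply: big_ind => //; [apply: subring0|apply: subringD]. Qed.
Lemma subringX x n : B x -> B (x ^+ n).
Proof.
move=> Bx; elim: n => [|n IHn]; first exact: subring1.
by rewrite exprS; apply: subringM.
Qed.
Lemma subring_nat n : B n%:R.
Proof.
elim: n => [|n IHn]; first exact: subring0.
by rewrite -addn1 natrD; apply: subringD => //; apply: subring1.
Qed.
Lemma subring_int (a : int) : B a%:~R.
Proof.
case: a => n; first exact: subring_nat.
by rewrite NegzE mulrNz; apply: subringN; apply: subring_nat.
Qed.

(** The ring [B[z]], as the set of values at [z] of polynomials over [B]. *)
Definition adjoin_set z : set F :=
  [set g.[z] | g in [set g : {poly F} | forall i, B g`_i]].

Lemma subring_adjoin z : subring_set (adjoin_set z).
Proof.
split=> [|_ _ [g Bg <-] [h Bh <-]|_ _ [g Bg <-] [h Bh <-]].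
- exists 1; rewrite ?hornerC //= => i; rewrite coef1.
  by case: (i == 0%N); [apply: subring1|apply: subring0].
- exists (g - h); rewrite ?hornerD ?hornerN //= => i.
  by rewrite coefB; apply: subringB.
- exists (g * h); rewrite ?hornerM //= => i.
  by rewrite coefM; apply: subring_sum => j _; apply: subringM.
Qed.

Lemma sub_adjoin z : B `<=` adjoin_set z.
Proof.
move=> a Ba; exists a%:P; rewrite ?hornerC //= => i; rewrite coefC.
by case: (i == 0%N) => //; apply: subring0.
Qed.

Lemma adjoin_gen z : adjoin_set z z.
Proof.
exists 'X; rewrite ?hornerX //= => i; rewrite coefX.
by case: (i == 1%N); [apply: subring1|apply: subring0].
Qed.

End Closure.

(** Maximality turns such a subring into a valuation ring of [F], with [x^-1]
    in its maximal ideal. *)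
Definition max_avoiding x B := [/\ subring_set B, B x^-1, ~ B x &
  forall B', subring_set B' -> B `<=` B' -> ~ B' x -> B' `<=` B].

Lemma max_avoiding_exists x B0 :
  subring_set B0 -> B0 x^-1 -> ~ B0 x -> exists B, max_avoiding x B.
Proof.
move=> ringB0 B0x nB0x.
pose good B := [/\ subring_set B, B x^-1 & ~ B x].
(* The empty set is admitted because the empty chain has empty union. *)
pose P B := B = set0 \/ good B.
have [|B [PB maxB]] := @Zorn_bigcup F P.
  move=> S SP totS.
  have [all0|/existsNP[B1 /not_implyP[SB1 nB1]]] :=
    pselect (forall B, S B -> B = set0).
    left; rewrite -subset0 => a [B SB]; by rewrite (all0 B SB).
  have [//|[ringB1 B1x _]] := SP _ SB1.
  right; split; last 1 first.
  - case=> B SB Bx; have [B_0|[_ _]] := SP _ SB; last exact.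
    by rewrite B_0 in Bx.
  - have pair a b : (\bigcup_(X in S) X) a -> (\bigcup_(X in S) X) b ->
        exists B, [/\ S B, subring_set B, B a & B b].
      move=> [X SX Xa] [Y SY Yb].
      have [XY|YX] := totS _ _ SX SY.
        exists Y; split=> //; last exact: XY.
        by have [Y0|[]] := SP _ SY; [rewrite Y0 in Yb|].
      exists X; split=> //; last exact: YX.
      by have [X0|[]] := SP _ SX; [rewrite X0 in Xa|].
    split=> [|a b Sa Sb|a b Sa Sb].
    + by exists B1 => //; apply: subring1.
    + have [B [SB ringB Ba Bb]] := pair _ _ Sa Sb.
      by exists B => //; apply: subringB.
    + have [B [SB ringB Ba Bb]] := pair _ _ Sa Sb.
      by exists B => //; apply: subringM.
  - by exists B1.
case: PB => [B_0|[ringB Bx nBx]].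
  case: (maxB B0); last by right; split.
  split; first by rewrite B_0.
  by rewrite B_0 => /(_ _ (subring1 ringB0)).
exists B; split=> // B' ringB' BB' nB'x; apply: contrapT => nB'B.
apply: (maxB B'); first by split.
by right; split=> //; apply: BB'.
Qed.

Section MaxAvoiding.
Variables (x : F) (B : set F).
Hypotheses (x0 : x != 0) (maxB : max_avoiding x B).

Let ringB : subring_set B. Proof. by case: maxB. Qed.
Let y := x^-1.
Let By : B y. Proof. by case: maxB. Qed.
Let nBx : ~ B x. Proof. by case: maxB. Qed.

Let adjoin_avoid z : ~ B z -> adjoin_set B z x.
Proof.
move=> nBz; apply: contrapT => nBzx; apply: nBz.
have [_ _ _ /(_ _ (subring_adjoin ringB z) (@sub_adjoin _ ringB z) nBzx)] := maxB.
by apply; apply: adjoin_gen.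
Qed.

(** [x^-1] lies in every maximal ideal of [B]: otherwise inverting
    [1 - x^-1 b] would give a larger ring, still without [x]. *)
Lemma max_avoiding_unit b : B b -> B (1 - y * b)^-1.
Proof.
move=> Bb; set u := 1 - y * b.
have Bu : B u by apply: subringB => //; [apply: subring1|apply: subringM].
have [->|u0] := eqVneq u 0; first by rewrite invr0; apply: subring0.
apply: contrapT => /adjoin_avoid[g Bg gu].
have [a Ba E] : exists2 a, B a & x * u ^+ (size g) = a.
  exists (\sum_(i < size g) g`_i * u ^+ (size g - i)).
    by apply: subring_sum => // i _; apply: subringM => //; apply: subringX.
  rewrite -gu horner_coef mulr_suml; apply: eq_bigr => i _.
  rewrite expfB_cond ?(negPf u0) ?add0n; last exact: ltnW (ltn_ord i).
  by rewrite exprVn -!mulrA [X in _ * X]mulrC.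
have [c Bc uc] : exists2 c, B c & u ^+ (size g) = 1 - y * c.
  elim: (size g) => [|k [c Bc IHk]].
    by exists 0; [apply: subring0|rewrite mulr0 subr0].
  exists (b + c - y * b * c).
    by do ![apply: subringB|apply: subringD|apply: subringM].
  by rewrite exprS IHk /u; ring.
apply: nBx; rewrite -[x](subrK (x * (y * c))).
apply: subringD => //; last by rewrite mulVKf.
suff -> : x - x * (y * c) = a by [].
by rewrite -E uc mulrBr mulr1.
Qed.

(** If neither [z] nor [z^-1] is in [B], adjoining each yields [x], hence the
    relations [x^-1 * g z = 1] and [x^-1 * h z^-1 = 1] with [g], [h] over [B].
    The one of smaller degree lowers the degree of the other. *)
Lemma max_avoiding_valuation z : B z \/ B z^-1.
Proof.
apply: contrapT => /not_orP[nBz nBz'].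
have z0 : z != 0 by apply: contra_notN nBz => /eqP->; apply: subring0.
pose S w n := exists g : {poly F}, [/\ forall i, B g`_i, (size g <= n)%N & y * g.[w] = 1].
have exS w : ~ B w -> exists n, S w n.
  move=> /adjoin_avoid[g Bg gx]; exists (size g), g; split=> //.
  by rewrite gx mulVf.
(* As [1 - y * h`_0] is a unit, the relation at [1/w] rewrites [w ^+ n] in
   terms of lower powers, with coefficients in [B]. *)
have red w n m : w != 0 -> (m <= n)%N -> S w n.+1 -> S w^-1 m.+1 -> S w n.
  move=> w0 mn [g [Bg szg gw]] [h [Bh szh hw]].
  set u := 1 - y * h`_0.
  have Bu : B u^-1 by apply: max_avoiding_unit.
  have u0 : u != 0.
    apply/eqP => uz; apply: nBx.
    suff -> : x = h`_0 by [].
    by move/subr0_eq: uz => E; rewrite -[h`_0]mul1r -(divff x0) -mulrA -E mulr1.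
  pose r : {poly F} := \poly_(i < n) (g`_i + u^-1 * y * g`_n * (if (n - i <= m)%N then h`_(n - i) else 0)).
  exists r; split.
  - move=> i; rewrite coef_poly; case: ifP => _; last exact: subring0.
    apply: subringD => //; apply: subringM => //; last by case: ifP => // _;
      exact: subring0.
    by apply: subringM => //; apply: subringM.
  - exact: size_poly.
  have gE : g.[w] = \sum_(i < n) g`_i * w ^+ i + g`_n * w ^+ n.
    by rewrite (horner_coef_wide _ szg) big_ord_recr.
  have hE : u = y * \sum_(i < m) h`_i.+1 * w^-1 ^+ i.+1.
    by rewrite /u -hw (horner_coef_wide _ szh) big_ord_recl /= expr0 mulr1 mulrDr addrC addKr.
  rewrite horner_poly -[RHS]gw gE.
  congr (_ * _); under eq_bigr do rewrite mulrDl; rewrite big_split; congr (_ + _).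
  have -> : g`_n * w ^+ n = \sum_(i < m) u^-1 * y * g`_n * (h`_i.+1 * w ^+ (n - i.+1)).
    rewrite -[g`_n in LHS]mulr1 -[1](mulVf u0) {2}hE !mulr_sumr mulr_suml.
    apply: eq_bigr => i _; rewrite expfB_cond ?(negPf w0) ?add0n;
      last exact: leq_trans (ltn_ord i) mn.
    by rewrite exprVn; ring.
  rewrite (reindex_inj rev_ord_inj) /=.
  rewrite (eq_bigr (fun i : 'I_n => if (i < m)%N then u^-1 * y * g`_n * (h`_i.+1 * w ^+ (n - i.+1)) else 0)); last first.
    move=> i _; rewrite subKn //; case: ifP => _; first by rewrite -!mulrA.
    by rewrite mulr0 mul0r.
  rewrite -big_mkcond (big_ord_widen n (fun i => u^-1 * y * g`_n * (h`_i.+1 * w ^+ (n - i.+1))) mn).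
  by [].
have nS0 w : ~ S w 0%N.
  move=> [g [_]]; rewrite leqn0 size_poly_eq0 => /eqP-> /eqP.
  by rewrite horner0 mulr0 eq_sym oner_eq0.
have key n m : S z n -> S z^-1 m -> False.
  elim: {n m}(n + m)%N {-2}n {-2}m (leqnn (n + m)) => [|k IHk] n m.
    by rewrite leqn0 addn_eq0 => /andP[/eqP-> _] /nS0.
  case: n => [|n]; first by move=> _ /nS0.
  case: m => [|m]; first by move=> _ _ /nS0.
  move=> le Sz Sz'; have [mn|/ltnW nm] := leqP m n.
    by apply: (IHk n m.+1) => //; exact: (red _ _ _ z0 mn).
  apply: (IHk n.+1 m) => //; first by rewrite addSnnS.
  by apply: (red z^-1 m n); rewrite ?invr_eq0 ?invrK.
have [n Sn] := exS _ nBz; have [m Sm] := exS _ nBz'.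
exact: key Sn Sm.
Qed.

End MaxAvoiding.
End Subrings.

(** * Integer dependence relations *)

Section IntegerDependence.
Variable K : fieldExtType rat.

Lemma ratzE (a : int) (x : K) : a%:~R *: x = a%:~R * x.
Proof. by rewrite scaler_int mulrzl. Qed.

Lemma intr_eq0K (a : int) : (a%:~R == 0 :> K) = (a == 0).
Proof. by rewrite -(rmorph_int (in_alg K)) fmorph_eq0 intr_eq0. Qed.

Lemma natr_eq0K (a : nat) : (a%:R == 0 :> K) = (a == 0%N).
Proof. by rewrite -[a%:R]/(a%:Z%:~R) intr_eq0K. Qed.

Lemma int_dependent m (x : 'I_m -> K) : (\dim {:K} < m)%N ->
  exists c : 'I_m -> int, \sum_i (c i)%:~R * x i = 0 /\ exists i, c i != 0.
Proof.
move=> dm; pose X := [tuple x i | i < m].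
have nfree : ~~ free X.
  by apply: contraL dm => /eqP; rewrite size_tuple -leqNgt => <-; apply: dimvS (subvf _).
have [k kX [i ki]] : exists2 k : 'I_m -> rat, \sum_i k i *: X`_i = 0 & exists i, k i != 0.
  apply: contrapT => nk; case/negP: nfree; apply/freeP => k kX i.
  by apply/eqP; apply: contrapT => /negP ki; apply: nk; exists k => //; exists i.
pose P : {poly rat} := \poly_(j < m) (if insub j is Some i then k i else 0).
have [q [a a0 PE]] := rat_poly_scale P.
have kE j : k j * a%:~R = (q`_j)%:~R.
  have -> : k j = P`_j by rewrite coef_poly ltn_ord valK.
  by rewrite PE coefZ coef_map /= mulrAC mulVf ?mul1r // intr_eq0.
exists (fun j => q`_j); split.
  transitivity (a%:~R *: \sum_i k i *: X`_i); last by rewrite kX scaler0.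
  rewrite scaler_sumr; apply: eq_bigr => j _.
  by rewrite -ratzE -kE scalerA mulrC -tnth_nth tnth_mktuple.
exists i; rewrite -(intr_eq0 rat) -kE mulf_neq0 ?intr_eq0 //.
Qed.

(** Dividing out common powers of [p] makes the relation nonzero modulo [p]. *)
Lemma int_dependent_prime m (x : 'I_m -> K) (p : nat) : prime p ->
  (\dim {:K} < m)%N ->
  exists c : 'I_m -> int,
    \sum_i (c i)%:~R * x i = 0 /\ exists i, ~~ (p %| c i)%Z.
Proof.
move=> p_pr /(int_dependent x)[c [cx [i ci]]].
elim: {c}`|c i|%N {-2}c (leqnn `|c i|) cx ci => [|b IHb] c.
  by rewrite leqn0 absz_eq0 => /eqP->; rewrite eqxx.
move=> cb cx ci.
have [[j nj]|/forallNP alldvd] := pselect (exists i, ~~ (p %| c i)%Z).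
  by exists c; split=> //; exists j.
have cE j : c j = (c j %/ p)%Z * p by rewrite divzK //; apply/negPn/negP/alldvd.
have p1 := prime_gt1 p_pr.
apply: (IHb (fun j => (c j %/ p)%Z)).
- by have := cE i; move: ci cb; move: (c i) (c i %/ p)%Z => u w; nia.
- have : (p%:Z%:~R : K) * (\sum_j ((c j %/ p)%Z)%:~R * x j) = 0.
    transitivity (\sum_j (c j)%:~R * x j); last exact: cx.
    rewrite mulr_sumr; apply: eq_bigr => j _.
    by rewrite [in RHS]cE intrM; ring.
  by move/eqP; rewrite mulf_eq0 intr_eq0K => /orP[/eqP|/eqP//]; lia.
- by apply: contraNneq ci => E; rewrite cE E mul0r.
Qed.

End IntegerDependence.

(** * From valuation rings to discrete valuations *)

Section Discretize.
Variables (K : fieldExtType rat) (B : set K).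
Hypotheses (ringB : subring_set B) (valB : forall z, B z \/ B z^-1).

Local Notation d := (\dim {:K}).
Let unitB z := B z /\ B z^-1.
Let maxB z := B z /\ (z = 0 \/ ~ B z^-1).

Let unitM z w : unitB z -> unitB w -> unitB (z * w).
Proof. by move=> [Bz Bz'] [Bw Bw']; split; rewrite ?invfM; apply: subringM. Qed.
Let unitV z : unitB z -> unitB z^-1.
Proof. by move=> [Bz Bz']; split; rewrite ?invrK. Qed.
Let unitX z n : unitB z -> unitB (z ^+ n).
Proof. by move=> [Bz Bz']; split; rewrite -?exprVn; apply: subringX. Qed.

Let unit1 : unitB 1. Proof. by split; rewrite ?invr1; apply: subring1. Qed.

Let maxM a b : maxB a -> B b -> maxB (a * b).
Proof.
move=> [Ba a'] Bb; split; first exact: subringM.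
have [->|b0] := eqVneq b 0; first by rewrite mulr0; left.
case: a' => [->|na']; first by rewrite mul0r; left.
right=> Bab; apply: na'; have := subringM ringB Bb Bab.
by rewrite invfM mulrCA divff ?mulr1.
Qed.

Let maxD a b : maxB a -> maxB b -> maxB (a + b).
Proof.
move=> ma mb.
have [->|a0] := eqVneq a 0; first by rewrite add0r.
have [->|b0] := eqVneq b 0; first by rewrite addr0.
have [Bab|] := valB (a / b).
  have -> : a + b = b * (1 + a / b) by field.
  by apply: maxM => //; apply: subringD => //; apply: subring1.
rewrite invf_div => Bba.
have -> : a + b = a * (1 + b / a) by field.
by apply: maxM => //; apply: subringD => //; apply: subring1.
Qed.

Let max0 : maxB 0. Proof. by split; [apply: subring0|left]. Qed.
Let nmax1 : ~ maxB 1.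
Proof. by move=> [_ [/eqP|]]; [rewrite oner_eq0|rewrite invr1; case; apply: subring1]. Qed.

Let normalB z n : (0 < n)%N -> B (z ^+ n) -> B z.
Proof.
case: n => // n _ Bzn; have [->|z0] := eqVneq z 0; first exact: subring0.
have [//|Bz'] := valB z.
suff -> : z = z ^+ n.+1 * z^-1 ^+ n by apply: subringM => //; apply: subringX.
by rewrite exprSr exprVn mulrAC divff ?mul1r// expf_neq0.
Qed.

(* Among the powers of [z] there is a vanishing rational combination, and the
   nonzero terms of a vanishing sum cannot have pairwise distinct values.  So
   some power of [z] has the value of a rational number. *)
Let tie z : z != 0 -> exists e (a b : int),
  [/\ (0 < e <= d)%N, a != 0, b != 0 & unitB (z ^+ e * (a%:~R / b%:~R))].
Proof.
move=> z0.
have [c [cz [i ci]]] := int_dependent (fun i : 'I_d.+1 => z ^+ i) (ltnSn _).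
pose t (i : 'I_d.+1) := (c i)%:~R * z ^+ i.
have t0 j : (t j == 0) = (c j == 0) by rewrite mulf_eq0 expf_eq0 (negPf z0) andbF orbF intr_eq0K.
have [i0 [ci0 mini0]] : exists i0, c i0 != 0 /\ forall j, B (t j / t i0).
  have [i0 [ci0 Hi0]] : exists i0, c i0 != 0 /\ forall j, j \in enum 'I_d.+1 ->
    B (t j / t i0).
    elim: (enum _) => [|j s [k [ck IHk]]]; first by exists i; split.
    have [Bjk|Bkj] := valB (t j / t k).
      by exists k; split=> // l; rewrite inE => /orP[/eqP->|/IHk].
    have [cj|cj] := eqVneq (c j) 0.
      exists k; split=> // l; rewrite inE => /orP[/eqP->|/IHk//].
      by rewrite (eqP (_ : t j == 0)) ?t0 ?cj // mul0r; apply: subring0.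
    exists j; split=> // l; rewrite inE => /orP[/eqP->|/IHk Blk].
      by rewrite divff ?t0 //; apply: subring1.
    move: Bkj; rewrite invf_div => /(subringM ringB Blk).
    by rewrite mulrA divfK ?t0.
  by exists i0; split=> // j; apply: Hi0; rewrite mem_enum.
have [j [cj ji0 Ut]] : exists j, [/\ c j != 0, j != i0 & unitB (t j / t i0)].
  apply: contrapT => /forallNP none; case: nmax1.
  have -> : 1 = -1 * (\sum_(j | j != i0) t j / t i0).
    apply: (@mulIf _ (t i0)); first by rewrite t0.
    rewrite mul1r mulN1r mulNr mulr_suml (eq_bigr t); last first.
      by move=> j _; rewrite divfK ?t0.
    by apply/eqP; rewrite -addr_eq0; apply/eqP; rewrite -[RHS]cz [RHS](bigD1 i0).
  rewrite mulrC; apply: maxM; last by apply: subringN => //; apply: subring1.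
  apply: (big_ind maxB) => // j ji0; split=> //.
  have [cj|cj] := eqVneq (c j) 0; first by left;
    rewrite (eqP (_ : t j == 0)) ?t0 ?cj // mul0r.
  by right=> Bt'; apply: (none j); split.
have tE (k l : 'I_d.+1) : (k < l)%N -> t l / t k = z ^+ (l - k) * ((c l)%:~R / (c k)%:~R).
  move=> kl; rewrite /t -(subnK (ltnW kl)) exprD addnK.
  have [->|ck] := eqVneq (c k) 0; first by rewrite mul0r invr0 !mulr0.
  have ck' : (c k)%:~R != 0 :> K by rewrite intr_eq0K.
  have zk : z ^+ k != 0 by rewrite expf_neq0.
  by field; rewrite ck' zk.
have [ltji|ltij|/val_inj E] := ltngtP j i0; last by rewrite E eqxx in ji0.
  exists (i0 - j)%N, (c i0), (c j); split=> //.
    by rewrite subn_gt0 ltji /= (leq_trans (leq_subr _ _)) // -ltnS.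
  by rewrite -tE // -invf_div; apply: unitV.
exists (j - i0)%N, (c j), (c i0); split=> //.
  by rewrite subn_gt0 ltij /= (leq_trans (leq_subr _ _)) // -ltnS.
by rewrite -tE.
Qed.

Variable x : K.
Hypotheses (x0 : x != 0) (Bx' : B x^-1) (nBx : ~ B x).

(* If every positive integer were invertible in [B], then [tie] would make
   some power of [x] an element of [B]; a least non-invertible one is prime. *)
Let residue_prime : exists2 p : nat, prime p & ~ B (p%:R^-1).
Proof.
have exN : exists N, `[< (0 < N)%N /\ ~ B (N%:R^-1) >].
  apply: contrapT => /forallNP allN; apply: nBx.
  have {}allN N : (0 < N)%N -> B (N%:R^-1).
    by move=> N0; apply: contrapT => nBN; apply: (allN N); apply/asboolP.
  have ZB (a : int) : a != 0 -> B (a%:~R^-1).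
    case: a => n an0; first by apply: allN; rewrite lt0n.
    by rewrite NegzE mulrNz invrN; apply: subringN => //; apply: allN.
  have [e [a [b [/andP[e0 _] a0 b0 [Bxe _]]]]] := tie x0.
  apply: (normalB e0); rewrite -[x ^+ e]mulr1 -(@divff _ (a%:~R / b%:~R)) ?mulf_neq0 ?invr_eq0 ?intr_eq0K //.
  by rewrite mulrA invf_div; do !apply: subringM => //; [apply: subring_int|apply: ZB].
have [p /asboolP[p0 nBp] minp] := ex_minnP exN.
exists p => //; apply/primeP; split.
  have [p1|//|p1] := ssrnat.ltngtP p 1%N; first by move: p0 p1; lia.
  by case: nBp; rewrite p1 invr1; apply: subring1.
move=> l /dvdnP[k pE]; have k0 : (0 < k)%N by move: p0; rewrite pE muln_gt0 => /andP[].
have l0 : (0 < l)%N by move: p0; rewrite pE muln_gt0 => /andP[].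
have [Bl|nBl] := pselect (B (l%:R^-1)).
  have nBk : ~ B (k%:R^-1).
    by move=> Bk; apply: nBp; rewrite pE natrM invfM; apply: subringM.
  have : (p <= k)%N by apply: minp; apply/asboolP.
  by rewrite {1}pE -[X in (_ <= X)%N -> _]muln1 leq_pmul2l // => l1; apply/orP; left; lia.
have : (p <= l)%N by apply: minp; apply/asboolP.
by rewrite {1}pE -[X in (_ <= X)%N -> _]mul1n leq_pmul2r // => k1; apply/orP; right;
rewrite pE (_ : k = 1)%N ?mul1n //; lia.
Qed.

(** The value group contains [Z], generated by the value of [p], with index
    at most [d], so multiplication by [d!] maps it into [Z].  This embeds it
    as a subgroup of [Z], hence makes it infinite cyclic. *)
Lemma valuation_subring_finite_place :
  exists2 v, finite_place v & v x < 0.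
Proof.
have [p p_pr nBp] := residue_prime.
have p0 : (p%:R : K) != 0 by rewrite natr_eq0K -lt0n prime_gt0.
have mp : maxB p%:R by split; [apply: subring_nat|right].
have coprimeU (N : nat) : coprime p N -> unitB N%:R.
  move=> cop; split; first exact: subring_nat.
  apply: contrapT => nBN; have mN : maxB N%:R by split; [apply: subring_nat|right].
  have N0 : (0 < N)%N by rewrite lt0n; apply/eqP => N0; apply: nBN; rewrite N0 invr0;
    apply: subring0.
  have [u v uv _] := egcdnP p N0; apply: nmax1.
  have -> : 1 = N%:R * u%:R + - (p%:R * v%:R) :> K.
    have := congr1 (fun k => k%:R : K) uv; rewrite gcdnC (eqP cop) !natrM natrD => E.
    by rewrite mulrC E natrM [X in X - _]addrC [v%:R * _]mulrC addrK.
  apply: maxD; first by apply: maxM => //; apply: subring_nat.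
  by rewrite -mulrN; apply: maxM => //; apply: subringN => //; apply: subring_nat.
have intU (a : int) : a != 0 -> exists e : int, unitB (a%:~R * p%:R ^ e).
  move=> a0; have a0' : (0 < `|a|)%N by rewrite absz_gt0.
  have [k npk aE] := pfactor_coprime p_pr a0'.
  set e := logn p `|a| in aE.
  exists (- e%:Z).
  rewrite [a]intEsign intrM -mulrA; apply: unitM.
    rewrite rmorphXn /= rmorphN1; apply: unitX.
    by split; rewrite ?invrN1; apply: subringN => //; apply: subring1.
  rewrite aE -pmulrn natrM natrX -invr_expz -exprnP mulfK ?expf_neq0 //.
  exact: coprimeU.
set E := d`!; have E0 : (0 < E)%N by exact: fact_gt0.
have exv z : exists N : int, z != 0 -> unitB (z ^+ E * p%:R ^ (- N)).
  have [->|z0] := eqVneq z 0; first by exists 0 => /eqP.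
  have [e [a [b [/andP[e0 ed] a0 b0 U]]]] := tie z0.
  have [u Uu] := intU a a0; have [w Uw] := intU b b0.
  have {}U : unitB (z ^+ e * p%:R ^ (w - u)).
    have -> : z ^+ e * p%:R ^ (w - u) = (z ^+ e * (a%:~R / b%:~R)) * (a%:~R * p%:R ^ u)^-1 * (b%:~R * p%:R ^ w).
      rewrite expfzDr // -invr_expz; have pu : (p%:R : K) ^ u != 0 by rewrite expfz_neq0.
      by field; rewrite pu !intr_eq0K a0 b0.
    by do !apply: unitM => //; apply: unitV.
  have /dvdnP[k Ek] : (e %| E)%N by apply: dvdn_fact; rewrite e0.
  exists (- ((w - u) * k)) => _; rewrite Ek mulnC exprM opprK -exprz_exp.
  by rewrite -[X in _ * X]exprnP -exprMn; apply: unitX.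
have [v0 Hv0] := choice exv.
have uniqp (N : int) : unitB (p%:R ^ N) -> N = 0.
  have pos (n : nat) : ~ B (p%:R ^- n.+1).
    by rewrite -exprVn => /(normalB (isT : (0 < n.+1)%N)).
  by case: N => [[|n]|n] //= [H1 H2]; exfalso; apply: (pos n).
have v0uniq z N : z != 0 -> unitB (z ^+ E * p%:R ^ (- N)) -> v0 z = N.
  move=> z0 H; apply/eqP; rewrite -subr_eq0; apply/eqP/uniqp.
  have := unitM H (unitV (Hv0 z z0)).
  rewrite invfM invr_expz opprK mulrACA divff ?mul1r ?expf_neq0 //.
  by rewrite -expfzDr // addrC.
have v0M z w : z != 0 -> w != 0 -> v0 (z * w) = v0 z + v0 w.
  move=> z0 w0; apply: v0uniq; first by rewrite mulf_neq0.
  by rewrite exprMn opprD expfzDr // mulrACA; apply: unitM; apply: Hv0.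
have v01 : v0 1 = 0 by apply: v0uniq; rewrite ?oner_eq0 // oppr0 expr1n mul1r expr0z.
have v0V z : z != 0 -> v0 z^-1 = - v0 z.
  move=> z0; apply/eqP; rewrite -addr_eq0 -v0M ?invr_eq0 // mulVf // v01 //.
have v0p : v0 p%:R = E by apply: v0uniq => //; rewrite exprnP -expfzDr // subrr expr0z.
have v0B z : z != 0 -> B z <-> 0 <= v0 z.
  move=> z0; have [H1 H2] := Hv0 z z0; split=> [Bz|v0z]; last first.
    apply: (normalB E0); rewrite -[z ^+ E](mulfK (_ : p%:R ^ (- v0 z) != 0)) ?expfz_neq0 //.
    rewrite invr_expz opprK; apply: subringM => //.
    by case: (v0 z) v0z => // n _; apply: subringX => //; case: mp.
  rewrite leNgt; apply/negP => v0z; apply: nBp.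
  move: H2; rewrite invfM invr_expz opprK => /(subringM ringB (subringX ringB E Bz)).
  rewrite mulVKf ?expf_neq0 //.
  by case: (v0 z) v0z => // n _; rewrite -[_ ^ Negz n]/(_ ^- n.+1) -exprVn =>
    /(normalB (isT : (0 < n.+1)%N)).
have v0D z w : z != 0 -> w != 0 -> z + w != 0 -> v0 z <= v0 w -> v0 z <= v0 (z + w).
  move=> z0 w0 zw0 le; have zw' : (z + w) / z != 0 by rewrite mulf_neq0 ?invr_eq0.
  have -> : z + w = z * ((z + w) / z) by rewrite mulrCA divff ?mulr1.
  rewrite v0M // lerDl; apply/v0B => //; rewrite mulrDl divff //.
  apply: subringD => //; first exact: subring1.
  by apply/v0B; rewrite ?mulf_neq0 ?invr_eq0 // v0M ?invr_eq0 // v0V // subr_ge0.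
have v0X z n : z != 0 -> v0 (z ^ (n : int)) = v0 z * n.
  move=> z0; have nn (m : nat) : v0 (z ^+ m) = v0 z * m.
    elim: m => [|m IHm]; first by rewrite expr0 v01 mulr0.
    by rewrite exprS v0M ?expf_neq0 // IHm; lia.
  by case: n => m; rewrite ?NegzE /= ?exprnP ?nn // -?invr_expz v0V ?expf_neq0 // nn; lia.
(* [v0] need not be onto: divide by its least positive value [g]. *)
have exg : exists g : nat, `[< (0 < g)%N /\ exists2 z, z != 0 & v0 z = g >].
  by exists E; apply/asboolP; split=> //; exists p%:R.
have [g /asboolP[g0 [pi pi0 v0pi]] ming] := ex_minnP exg.
have gdvd z : z != 0 -> v0 z = (v0 z %/ g)%Z * g.
  move=> z0; set q := (v0 z %/ g)%Z; rewrite {1}(divz_eq (v0 z) g) -/q.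
  suff -> : (v0 z %% g)%Z = 0 by rewrite addr0.
  have r_lt : (v0 z %% g)%Z < g by apply: ltz_pmod.
  have r_ge : 0 <= (v0 z %% g)%Z by apply: modz_ge0; lia.
  apply/eqP; apply: contrapT => /negP r0.
  have w0 : pi ^ (- q) != 0 by rewrite expfz_neq0.
  have : (g <= `|(v0 z %% g)%Z|)%N.
    apply: ming; apply/asboolP; split; first by rewrite absz_gt0.
    exists (z * pi ^ (- q)); first by rewrite mulf_neq0.
    rewrite v0M // v0X // v0pi gez0_abs //.
    by rewrite {1}(divz_eq (v0 z) g) -/q; lia.
  by move: r_lt r_ge; lia.
have g0' : (0 : int) < g by [].
exists (fun z => if z == 0 then 0 else (v0 z %/ g)%Z); last first.
  rewrite (negPf x0) ltNge; apply/negP => le; apply: nBx; apply/v0B => //.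
  by rewrite (gdvd x x0) mulr_ge0.
split.
- by rewrite eqxx.
- move=> z w z0 w0; rewrite mulf_eq0 (negPf z0) (negPf w0) /= v0M //.
  by rewrite {1}(gdvd z z0) divzMDl ?lt0r_neq0 //.
- move=> z w z0 w0 zw0; rewrite (negPf z0) (negPf w0) (negPf zw0).
  have mono a b : a != 0 -> b != 0 -> v0 a <= v0 b -> (v0 a %/ g)%Z <= (v0 b %/ g)%Z.
    by move=> a0 b0; rewrite (gdvd a a0) (gdvd b b0) ler_pM2r // !mulzK // lt0r_neq0.
  have [le|/ltW le] := leP (v0 z) (v0 w); rewrite ge_min.
    by rewrite mono // v0D.
  by rewrite orbC mono // addrC v0D // addrC.
- move=> n; exists (pi ^ n); first by rewrite expfz_neq0.
  by rewrite (negPf (expfz_neq0 _ pi0)) v0X // v0pi mulrC mulzK //; lia.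
Qed.

End Discretize.

(** * Finiteness modulo a prime *)

Notation integral x := (integralOver (intr : int -> _) x).

Lemma prime_bezout (p : nat) (a : int) : prime p -> ~~ (p %| a)%Z ->
  exists u w : int, a * u = 1 + p%:Z * w.
Proof.
move=> p_pr npa; have cop : coprimez a p.
  by rewrite coprimez_sym coprimezE prime_coprime // -dvdzE.
have [u [w uw]] := Bezoutz a p; exists u, (- w).
by move: uw; rewrite (eqP (_ : gcdz a p == 1)) // => <-; ring.
Qed.

Section Finiteness.

Lemma finite_injective_on (U : Type) (T : finType) (A : set U) (f : U -> T) :
  (forall u w, A u -> A w -> f u = f w -> u = w) -> finite_set A.
Proof.
move=> finj; have [[a Aa]|noA] := pselect (exists a, A a); last first.
  suff -> : A = set0 by exact: finite_set0.
  by rewrite -subset0 => a Aa; apply: noA; exists a.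
have [g gf] : exists g : T -> U, forall u, A u -> g (f u) = u.
  have /choice[g Hg] t : exists w, (exists2 u, A u & f u = t) -> A w /\ f w = t.
    have [[u Au fu]|no] := pselect (exists2 u, A u & f u = t); first by exists u.
    by exists a => /no.
  exists g => u Au; have [|Ag fg] := Hg (f u); first by exists u.
  exact: finj.
apply: (@sub_finite_set _ _ [set g t | t in [set: T]]).
  by move=> u Au; exists (f u) => //; apply: gf.
by apply: finite_image; apply: finite_finset.
Qed.

Variables (K : fieldExtType rat) (p : nat) (S : set K).
Hypotheses (p_pr : prime p) (S0 : S 0) (SB : forall x y, S x -> S y -> S (x - y)).

Let SN x : S x -> S (- x).
Proof. by move=> Sx; rewrite -sub0r; apply: SB. Qed.
Let SD x y : S x -> S y -> S (x + y).
Proof. by move=> Sx Sy; rewrite -[y]opprK; apply: SB => //; apply: SN. Qed.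
Let SZ (a : int) x : S x -> S (a%:~R * x).
Proof.
move=> Sx; have Sn (n : nat) : S (n%:R * x).
  elim: n => [|n IHn]; first by rewrite mul0r.
  by rewrite -addn1 natrD mulrDl mul1r; apply: SD.
case: a => n; first exact: Sn.
by rewrite NegzE mulrNz mulNr; apply: SN; apply: Sn.
Qed.
Let Ssum (I : Type) (r : seq I) (P : pred I) (E : I -> K) :
  (forall i, P i -> S (E i)) -> S (\sum_(i <- r | P i) E i).
Proof. by move=> SE; apply: big_ind => //; apply: SD. Qed.

Let pS x := exists2 z, S z & x = p%:R * z.
Let indep m (e : 'I_m -> K) := (forall i, S (e i)) /\
  forall c : 'I_m -> int, pS (\sum_i (c i)%:~R * e i) -> forall i, (p %| c i)%Z.

(** Elements independent modulo [p S] are linearly independent over [rat], so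
    there are boundedly many of them, and a maximal such family spans [S]
    modulo [p S]. *)
Lemma finite_mod_prime : exists r : seq K,
  (forall y, y \in r -> S y) /\
  forall x, S x -> exists y, y \in r /\ exists2 z, S z & x - y = p%:R * z.
Proof.
have bound m : `[< exists e : 'I_m -> K, indep e >] -> (m <= \dim {:K})%N.
  move=> /asboolP[e [Se ie]]; rewrite leqNgt; apply/negP => dm.
  have [c [ce [i ci]]] := int_dependent_prime e p_pr dm.
  by move: ci; rewrite ie // ce; exists 0; rewrite ?mulr0.
have ex0 : exists m, `[< exists e : 'I_m -> K, indep e >].
  by exists 0%N; apply/asboolP; exists (fun=> 0); split=> [[]|c _ []].
have [m /asboolP[e [Se ie]] maxm] := ex_maxnP ex0 bound.
pose comb (f : {ffun 'I_m -> 'I_p}) := \sum_i (f i)%:R * e i.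
exists [seq comb f | f : {ffun 'I_m -> 'I_p}]; split.
  by move=> _ /mapP[f _ ->]; apply: Ssum => i _; apply: (@SZ (f i)).
move=> x Sx.
pose e' (i : 'I_m.+1) := if unlift ord0 i is Some j then e j else x.
have : ~ indep e'.
  move=> ie'; have : (m.+1 <= m)%N by apply: maxm; apply/asboolP; exists e'.
  by rewrite ltnn.
move=> /not_andP[|]; first by case=> i; rewrite /e'; case: unliftP => [j|] _.
move=> /existsNP[c] /not_implyP[[z Sz cz] nall].
move: cz; rewrite big_ord_recl {1}/e' unlift_none => cz.
have {}cz : (c ord0)%:~R * x + \sum_i (c (lift ord0 i))%:~R * e i = p%:R * z.
  by rewrite -cz; congr (_ + _); apply: eq_bigr => i _; rewrite /e' liftK.
have np : ~~ (p %| c ord0)%Z.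
  apply/negP => /dvdzP[t ct]; apply: nall => i.
  have [j ->|->] := unliftP ord0 i; last by apply/dvdzP; exists t.
  apply: (ie (fun i => c (lift ord0 i))).
  exists (z - t%:~R * x); first by apply: SB => //; apply: SZ.
  by rewrite mulrBr -cz ct intrM; ring.
have [u [w uw]] 
  := prime_bezout p_pr np.
have p0 : (0 < p)%N by apply: prime_gt0.
pose q i := ((- u * c (lift ord0 i)) %% p)%Z.
have qE i : exists f : 'I_p, q i = f.
  have q0 : 0 <= q i by apply: modz_ge0; lia.
  have qp : q i < p by apply: ltz_pmod.
  have lt : (`|q i| < p)%N by lia.
  by exists (Ordinal lt); rewrite /= gez0_abs.
have [f fE] := choice qE.
exists (comb [ffun i => f i]); split; first by apply: map_f; rewrite mem_enum.
exists (u%:~R * z - w%:~R * x + \sum_i ((- u * c (lift ord0 i)) %/ p)%Z%:~R * e i).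
  by apply: SD; [apply: SB; apply: SZ|apply: Ssum => i _; apply: SZ].
have uw' : (c ord0)%:~R * u%:~R = 1 + p%:R * w%:~R :> K.
  by have := congr1 (fun k : int => k%:~R : K) uw; rewrite intrM intrD intrM.
have xE : x = u%:~R * p%:R * z - p%:R * w%:~R * x - u%:~R * \sum_i (c (lift ord0 i))%:~R * e i.
  by rewrite -mulrA -cz mulrDr addrAC addrK [u%:~R * _]mulrA [u%:~R * _]mulrC uw'; ring.
have combE : - (u%:~R * \sum_i (c (lift ord0 i))%:~R * e i) - comb [ffun i => f i] =
    p%:R * \sum_i ((- u * c (lift ord0 i)) %/ p)%Z%:~R * e i.
  rewrite !mulr_sumr -!sumrN -big_split; apply: eq_bigr => i _; rewrite /= ffunE.
  have := divz_eq (- u * c (lift ord0 i)) p; rewrite -/(q i) fE.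
  move=> /(congr1 (fun k : int => k%:~R : K)); rewrite intrD !intrM mulrNz -pmulrn => E.
  by rewrite mulrA -mulNr -mulNr E -pmulrn; ring.
by rewrite {1}xE -addrA combE; ring.
Qed.

End Finiteness.

(** * Finite places *)

Section Places.
Variable K : fieldExtType rat.
Implicit Types (v w : K -> int) (x y z : K).

(** If [x] is not integral then it is not in [Z[1/x]]: clearing powers of [x]
    in [x = g(1/x)] gives a monic equation.  So [Z[1/x]] extends to a maximal
    subring avoiding [x], which is the ring of a place. *)
Lemma nonintegral_place x : ~ integral x -> exists2 v, finite_place v & v x < 0.
Proof.
move=> nix; have x0 : x != 0 by apply: contra_notN nix => /eqP->; apply: integral0.
pose Z : set K := [set a%:~R | a in [set: int]].
have ringZ : subring_set Z.
  split=> [|_ _ [a _ <-] [b _ <-]|_ _ [a _ <-] [b _ <-]].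
  - by exists 1.
  - by exists (a - b) => //; rewrite intrB.
  - by exists (a * b) => //; rewrite intrM.
have nx : ~ adjoin_set Z x^-1 x.
  move=> [g Zg gx]; apply: nix.
  have /choice[a aE] i : exists a : int, a%:~R = g`_i by have [a _ <-] := Zg i; exists a.
  pose n := size g; pose q : {poly int} := \sum_(i < n) a i *: 'X^(n - i).
  have szq : (size q < size ('X^(n.+1) : {poly int}))%N.
    rewrite size_polyXn ltnS; apply: leq_trans (size_sum _ _ _) _.
    apply/bigmax_leqP => i _; apply: leq_trans (size_scale_leq _ _) _.
    by rewrite size_polyXn ltnS leq_subr.
  exists ('X^(n.+1) - q).
    by rewrite monicE lead_coefDl ?size_polyN // lead_coefXn.
  rewrite rmorphB /= map_polyXn rootE hornerD hornerN hornerXn /q rmorph_sum horner_sum /=.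
  rewrite subr_eq0; apply/eqP.
  rewrite exprS -{1}gx (horner_coef_wide _ (leqnn n)) mulr_suml; apply: eq_bigr => i _.
  rewrite map_polyZ map_polyXn hornerZ hornerXn /= aE -mulrA exprVn; congr (_ * _).
  by rewrite mulrC expfB // ltn_ord.
have [B maxB] := max_avoiding_exists (subring_adjoin ringZ x^-1) (adjoin_gen ringZ x^-1) nx.
have [ringB Bx' nBx _] := maxB.
exact: (valuation_subring_finite_place ringB (max_avoiding_valuation x0 maxB) x0).
Qed.

Section OnePlace.
Variables (v : K -> int) (v_place : finite_place v).

Lemma placeM x y : x != 0 -> y != 0 -> v (x * y) = v x + v y.
Proof. by case: v_place => _ + _ _; apply. Qed.

Lemma place1 : v 1 = 0.
Proof.
have := @placeM 1 1 (oner_neq0 K) (oner_neq0 K).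
by rewrite mulr1 => /eqP; rewrite -subr_eq0 opprD addrA subrr sub0r oppr_eq0 => /eqP.
Qed.

Lemma placeV x : x != 0 -> v x^-1 = - v x.
Proof. by move=> x0; apply/eqP; rewrite -addr_eq0 -placeM ?invr_eq0 // mulVf // place1. Qed.

Lemma placeX x (n : nat) : x != 0 -> v (x ^+ n) = v x * n.
Proof.
move=> x0; elim: n => [|n IHn]; first by rewrite expr0 place1 mulr0.
by rewrite exprS placeM ?expf_neq0 // IHn; lia.
Qed.

Lemma placeXz x (n : int) : x != 0 -> v (x ^ n) = v x * n.
Proof.
move=> x0; case: n => n; first by rewrite -placeX.
by rewrite -[x ^ _]/(x ^- n.+1) placeV ?expf_neq0 // placeX // NegzE; lia.
Qed.

Lemma placeN x : v (- x) = v x.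
Proof.
have [->|x0] := eqVneq x 0; first by rewrite oppr0.
rewrite -mulN1r placeM ?oppr_eq0 ?oner_eq0 //.
suff -> : v (-1) = 0 by rewrite add0r.
have := @placeX (-1) 2; rewrite sqrrN expr1n place1 oppr_eq0 oner_eq0 => /(_ isT); lia.
Qed.

Lemma place_surj n : exists2 x, x != 0 & v x = n.
Proof. by case: v_place => _ _ _; apply. Qed.

Local Notation O := (valuation_ring v).
Local Notation M := (valuation_ideal v).

Lemma place_addr (a : int) x y : (x = 0 \/ a <= v x) -> (y = 0 \/ a <= v y) ->
  (x + y = 0 \/ a <= v (x + y)).
Proof.
have [->|x0] := eqVneq x 0; first by rewrite add0r.
have [->|y0] := eqVneq y 0; first by rewrite addr0.
have [->|xy0] := eqVneq (x + y) 0; first by left.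
move=> [/eqP|vx]; first by rewrite (negPf x0).
move=> [/eqP|vy]; first by rewrite (negPf y0).
right; case: v_place => _ _ /(_ x y x0 y0 xy0) + _; apply: le_trans.
by rewrite le_min vx vy.
Qed.

Lemma subring_valuation_ring : subring_set O.
Proof.
split=> [|x y Ox Oy|x y].
- by right; rewrite place1.
- by apply: place_addr => //; rewrite placeN; case: Oy => [->|]; [left;
  rewrite oppr0|right].
- have [->|x0] := eqVneq x 0; first by rewrite mul0r; left.
  have [->|y0] := eqVneq y 0; first by rewrite mulr0; left.
  move=> [/eqP|vx]; first by rewrite (negPf x0).
  move=> [/eqP|vy]; first by rewrite (negPf y0).
  by right; rewrite placeM // addr_ge0.
Qed.

Lemma ideal_valuation_ring x : M x -> O x.
Proof. by case=> [->|/ltW]; [left|right]. Qed.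

Lemma valuation_idealD x y : M x -> M y -> M (x + y).
Proof. by rewrite /valuation_ideal/= !gtz0_ge1; apply: place_addr. Qed.

Lemma valuation_idealN x : M x -> M (- x).
Proof. by case=> [->|vx]; [left; rewrite oppr0|right; rewrite placeN]. Qed.

Lemma valuation_idealM x y : M x -> O y -> M (x * y).
Proof.
have [->|x0] := eqVneq x 0; first by rewrite mul0r; left.
have [->|y0] := eqVneq y 0; first by rewrite mulr0; left.
move=> [/eqP|vx]; first by rewrite (negPf x0).
move=> [/eqP|vy]; first by rewrite (negPf y0).
by right; rewrite placeM // ltr_pwDl.
Qed.

Lemma valuation_ideal1 : ~ M 1.
Proof. by case=> [/eqP|]; rewrite ?oner_eq0 // place1. Qed.

Lemma place_int (a : int) : O a%:~R.
Proof. exact: subring_int subring_valuation_ring a. Qed.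

Lemma place_int_coprime (p : nat) (a : int) :
  prime p -> M p%:R -> ~~ (p %| a)%Z -> ~ M a%:~R.
Proof.
move=> p_pr Mp /(prime_bezout p_pr)[u [w uw]] Ma; apply: valuation_ideal1.
have -> : 1 = a%:~R * u%:~R + - (p%:R * w%:~R) :> K.
  by have := congr1 (fun k : int => k%:~R : K) uw;
    rewrite intrM intrD intrM -pmulrn => ->; ring.
apply: valuation_idealD; last apply: valuation_idealN.
  by apply: valuation_idealM => //; apply: place_int.
by apply: valuation_idealM => //; apply: place_int.
Qed.

Let coset x := [set y : K | M (y - x)].

(** The residue field is a quotient of the finite ring [O / p O]. *)
Lemma residue_set_finite (p : nat) : prime p -> M p%:R ->
  finite_set [set coset x | x in O].
Proof.
move=> p_pr Mp.
have [r [rO Hr]] := finite_mod_prime p_pr (subring0 subring_valuation_ring) (subringB subring_valuation_ring).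
apply: (@sub_finite_set _ _ [set coset x | x in [set` r]]); last by apply: finite_image;
  apply: finite_seq.
move=> _ [x Ox <-]; have [y [yr [z Oz xy]]] := Hr x Ox; exists y => //.
have Mxy : M (x - y) by rewrite xy; apply: valuation_idealM.
apply/seteqP; split=> t; rewrite /coset /= => Mt.
  have -> : t - x = (t - y) - (x - y) by ring.
  by apply: valuation_idealD => //; apply: valuation_idealN.
have -> : t - y = (t - x) + (x - y) by ring.
exact: valuation_idealD.
Qed.

(** Integers prime to [p] are units at [v], so the residues of
    [0, ..., p - 1] are distinct. *)
Lemma residue_card_ge (p : nat) : prime p -> M p%:R -> (p <= residue_card v)%N.
Proof.
move=> p_pr Mp; have fin := residue_set_finite p_pr Mp.
rewrite /residue_card -{1}(size_iota 0 p) -(size_map (fun i => coset i%:R)).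
apply: uniq_leq_size.
  rewrite map_inj_in_uniq ?iota_uniq // => i j; rewrite !mem_iota !add0n /= => ip jp ij.
  have : M (i%:R - j%:R).
    by have : coset j%:R i%:R by rewrite -ij /coset/= subrr; left.
  have -> : i%:R - j%:R = (i%:Z - j%:Z)%:~R :> K by rewrite intrB.
  move=> Mij; apply/eqP; apply: contrapT => /negP nij.
  apply: (place_int_coprime p_pr Mp _ Mij); rewrite dvdzE; apply/negP => /dvdn_leq; lia.
by move=> _ /mapP[i _ ->]; rewrite in_fset_set // inE; exists i%:R => //;
  apply: (place_int i).
Qed.

End OnePlace.

Lemma integral_place v x : finite_place v -> integral x -> valuation_ring v x.
Proof.
move=> vp [q mq qx]; have [->|x0] := eqVneq x 0; first by left.
right; rewrite leNgt; apply/negP => vx.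
have ringO := subring_valuation_ring vp.
have Ox' : valuation_ring v x^-1 by right; rewrite placeV //; lia.
have szq : size q = (size q).-1.+1 by rewrite prednK // lt0n size_poly_eq0 monic_neq0.
have szm : (size (map_poly intr q : {poly K}) <= size q)%N by exact: size_poly.
have qE : x ^+ (size q).-1 = - \sum_(i < (size q).-1) (q`_i)%:~R * x ^+ i.
  move: qx; rewrite rootE (horner_coef_wide _ szm) szq big_ord_recr /=.
  rewrite !coef_map /= -/(lead_coef q) (monicP mq) mul1r addr_eq0 => /eqP E.
  by rewrite -[LHS]opprK -E; congr (- _); apply: eq_bigr => i _; rewrite coef_map.
case: (size q).-1 qE => [|n] qE.
  by move: qE => /eqP; rewrite big_ord0 oppr0 expr0 oner_eq0.
have : valuation_ring v x.
  have -> : x = x ^+ n.+1 * x^-1 ^+ n.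
    by rewrite exprSr exprVn mulrAC divff ?mul1r // expf_neq0.
  rewrite qE mulNr mulr_suml; apply: subringN => //; apply: subring_sum => // i _.
  rewrite -mulrA; apply: subringM => //; first exact: place_int.
  have -> : x ^+ i * x^-1 ^+ n = x^-1 ^+ (n - i).
    by rewrite !exprVn expfB_cond ?(negPf x0) ?add0n -1?ltnS // invf_div.
  exact: subringX.
by case=> [/eqP|]; [rewrite (negPf x0)|lia].
Qed.

End Places.

(** * Places over a prime *)

Section PlacesOverPrime.
Variables (K : fieldExtType rat) (p : nat) (p_pr : prime p).
Implicit Types (v w : K -> int) (x y z : K).

Definition places_over : set (K -> int) :=
  [set v | finite_place v /\ 0 < v p%:R].

Let S : set K := [set x | forall u, places_over u -> valuation_ring u x].

Let Mp v : places_over v -> valuation_ideal v p%:R.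
Proof. by case=> _; right. Qed.

(** Let [sum_i c_i z^i = 0] be a relation nonzero modulo [p], and
    [b_j = sum_(i >= j) c_i z^(i - j)].  Every [b_j] and every
    [z b_(j+1) = b_j - c_j] is integral over [p].  If [v z > 0 > w z], then
    all of them are in the maximal ideal of [w], hence in that of [v], hence
    so is every [c_j]. *)
Lemma place_le_of_ideal v w : places_over v -> places_over w ->
  (forall x, S x -> valuation_ideal v x <-> valuation_ideal w x) ->
  forall z, z != 0 -> 0 < v z -> 0 <= w z.
Proof.
move=> pv pw vw z z0 vz; rewrite leNgt; apply/negP => wz.
have [vp _] := pv; have [wp _] := pw.
have [c [cz [i0 /negP ci0]]] := int_dependent_prime (fun i :
  'I_(\dim {:K}).+1 => z ^+ i) p_pr (ltnSn _).
set d := (\dim {:K}).+1 in c cz i0 ci0.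
pose a n : K := if insub n is Some i then (c i)%:~R else 0.
have aO u n : places_over u -> valuation_ring u (a n).
  by move=> [up _]; rewrite /a; case: insub => [i|]; [apply: place_int|left].
have az : \sum_(0 <= i < d) a i * z ^+ i = 0.
  by rewrite big_mkord -[RHS]cz; apply: eq_bigr => i _; rewrite /a valK.
pose b j := \sum_(j <= i < d) a i * z ^+ (i - j).
have bS j : b j = a j + z * b j.+1.
  have [jd|dj] := ltnP j d; last first.
    rewrite /b !big_geq ?mulr0 ?addr0 1?leqW // /a insubN // -leqNgt //.
  rewrite /b big_ltn // subnn mulr1 mulr_sumr; congr (_ + _).
  apply: eq_big_nat => i /andP[ji _]; rewrite mulrCA -exprS; congr (_ * _ ^+ _).
  by rewrite -subSn // subSS.
have zb j : z * b j.+1 = b j - a j by rewrite (bS j) addrAC subrr add0r.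
have bE j : (j <= d)%N -> z ^+ j * b j = - \sum_(0 <= i < j) a i * z ^+ i.
  move=> jd; apply/eqP; rewrite -addr_eq0 addrC; apply/eqP; rewrite -[RHS]az.
  rewrite [RHS](@big_cat_nat _ _ _ j) //=; congr (_ + _); rewrite mulr_sumr.
  by apply: eq_big_nat => i /andP[ji _]; rewrite mulrCA -exprD subnKC.
have Sb j : S (b j).
  move=> u pu; have [up _] := pu.
  have ringO := subring_valuation_ring up.
  have [uz|uz] := leP 0 (u z).
    apply: subring_sum => // i _; apply: subringM => //; first exact: aO.
    by apply: subringX => //; right.
  have [dj|jd] := ltnP d j; first by rewrite /b big_geq 1?ltnW //; left.
  have -> : b j = - \sum_(i < j) a i * z^-1 ^+ (j - i).
    apply: (@mulfI _ (z ^+ j)); first by rewrite expf_neq0.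
    rewrite bE // mulrN big_mkord mulr_sumr; congr (- _); apply: eq_bigr => i _.
    rewrite mulrCA; congr (_ * _); rewrite exprVn -expfB_cond ?subKn //.
    - exact: ltnW.
    - by rewrite (negPf z0) leq_subr.
  apply: subringN => //; apply: subring_sum => // i _; apply: subringM => //;
    first exact: aO.
  by apply: subringX => //; right; rewrite placeV //; lia.
have Sa j : S (a j) by move=> u; apply: aO.
have Szb j : S (z * b j.+1).
  by rewrite zb => u pu; apply: (subringB (subring_valuation_ring pu.1));
    [apply: Sb|apply: Sa].
have vzb j : valuation_ideal v (z * b j.+1).
  by apply: valuation_idealM => //; [right|apply: Sb].
have vb j : valuation_ideal v (b j).
  case: j => [|j].
    suff -> : b 0%N = 0 by left.
    by rewrite -[RHS]az; apply: eq_bigr => i _; rewrite subn0.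
  apply/(vw _ (Sb _)); rewrite -[b j.+1](mulKf z0) mulrC; apply: valuation_idealM => //.
    by apply/(vw _ (Szb _)).
  by right; rewrite placeV //; lia.
apply: (place_int_coprime vp p_pr (Mp pv) (introN idP ci0)).
have -> : (c i0)%:~R = b i0 - z * b i0.+1 by rewrite zb opprB addrC subrK /a valK.
by apply: valuation_idealD => //; apply: valuation_idealN.
Qed.

(** By [place_le_of_ideal] the valuation rings agree: if [v z = 0 > w z], then
    a large power of [z] times a uniformizer of [v] is positive at [v] and
    negative at [w].  A surjective valuation is determined by its ring. *)
Lemma place_eq_of_ideal v w : places_over v -> places_over w ->
  (forall x, S x -> valuation_ideal v x <-> valuation_ideal w x) -> v = w.
Proof.
move=> pv pw vw; have [vp _] := pv; have [wp _] := pw.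
have ge0 v1 w1 : places_over v1 -> places_over w1 ->
    (forall x, S x -> valuation_ideal v1 x <-> valuation_ideal w1 x) ->
    forall z, z != 0 -> 0 <= v1 z -> 0 <= w1 z.
  move=> pv1 pw1 vw1 z z0 v1z; have [vp1 _] := pv1; have [wp1 _] := pw1.
  rewrite leNgt; apply/negP => w1z.
  have [pi pi0 vpi] := place_surj vp1 1.
  pose t := z ^+ (`|w1 pi|%N).+1 * pi.
  have zn0 : z ^+ (`|w1 pi|%N).+1 != 0 by rewrite expf_neq0.
  have : 0 <= w1 t.
    apply: (place_le_of_ideal pv1 pw1 vw1); first by rewrite mulf_neq0.
    by rewrite placeM // placeX // vpi ltr_wpDl // mulr_ge0.
  rewrite placeM // placeX //; move: w1z; move: (w1 z) (w1 pi) => a b; nia.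
have wv x : S x -> valuation_ideal w x <-> valuation_ideal v x by move=> /vw[]; split.
have eq0 z : z != 0 -> v z = 0 -> w z = 0.
  move=> z0 vz; have := ge0 v w pv pw vw z z0; rewrite vz => /(_ (lexx _)).
  have := ge0 v w pv pw vw z^-1; rewrite invr_eq0 placeV // vz => /(_ z0 (lexx _)).
  by rewrite placeV //; lia.
have [pi pi0 vpi] := place_surj vp 1.
have wE z : z != 0 -> w z = v z * w pi.
  move=> z0; have zp0 : pi ^ (- v z) != 0 by rewrite expfz_neq0.
  have : w (z * pi ^ (- v z)) = 0.
    apply: eq0; first by rewrite mulf_neq0.
    by rewrite placeM // placeXz // vpi; lia.
  by rewrite placeM // placeXz //; lia.
have wpi : w pi = 1.
  have : 0 <= w pi by apply: (ge0 v w) => //; rewrite vpi.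
  have [y y0 wy] := place_surj wp 1; have := wE y y0; rewrite wy.
  by move=> /(congr1 absz); rewrite abszM => /esym/eqP;
    rewrite muln_eq1 => /andP[_ /eqP]; lia.
apply/funext => z; have [->|z0] := eqVneq z 0; last by rewrite wE // wpi mulr1.
by have [-> _ _ _] := vp; have [-> _ _ _] := wp.
Qed.

(** A place over [p] is determined by the set of those representatives of
    [S / p S] that lie in its ideal, where [S] is the ring of the elements
    integral at all places over [p]. *)
Lemma places_over_finite : finite_set places_over.
Proof.
have S0 : S 0 by move=> u _; left.
have SB x y : S x -> S y -> S (x - y).
  by move=> Sx Sy u pu; apply: (subringB (subring_valuation_ring pu.1));
    [apply: Sx|apply: Sy].
have [r [rS Hr]] := finite_mod_prime p_pr S0 SB.
apply: (@finite_injective_on _ {ffun 'I_(size r) -> bool} _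
  (fun v => [ffun i => `[< valuation_ideal v (tnth (in_tuple r) i) >]])) => v w pv pw.
move=> /ffunP eqvw; apply: place_eq_of_ideal => // x Sx.
have [y [/seq_tnthP[i ->] [z Sz xy]]] := Hr x Sx; set yi := tnth _ i in xy *.
have Mxy u : places_over u -> valuation_ideal u (x - yi).
  by move=> pu; rewrite xy; apply: valuation_idealM => //; [case: pu|apply: Mp|apply: Sz].
have xyE u : places_over u -> valuation_ideal u x <-> valuation_ideal u yi.
  move=> pu; split=> Mx.
    have -> : yi = x - (x - yi) by ring.
    by apply: valuation_idealD; [case: pu|..|apply: valuation_idealN;
      [case: pu|apply: Mxy]].
  have -> : x = yi + (x - yi) by ring.
  by apply: valuation_idealD; [case: pu|..|apply: Mxy].
have := eqvw i; rewrite !ffunE => E.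
by split=> H; apply/xyE => //; apply/asboolP; [rewrite -E|rewrite E]; apply/asboolP/xyE.
Qed.

End PlacesOverPrime.

(** * Denominators and conjugates bounded by the height *)

Section Heights.
Variable K : fieldExtType rat.
Implicit Types (v w : K -> int) (x y z : K).

Lemma integer_polynomial x : exists2 q : {poly int}, q != 0 & root (map_poly intr q) x.
Proof.
have [c [cx [i ci]]] := int_dependent (fun i : 'I_(\dim {:K}).+1 => x ^+ i) (ltnSn _).
pose q := \poly_(j < (\dim {:K}).+1) (if insub j is Some i then c i else 0).
have qE (j : 'I_(\dim {:K}).+1) : q`_j = c j by rewrite coef_poly ltn_ord valK.
exists q; first by apply: contraNneq ci => q0; rewrite -qE q0 coef0.
have szq : (size (map_poly intr q : {poly K}) <= (\dim {:K}).+1)%N.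
  by apply: leq_trans (size_poly _ _) (size_poly _ _).
rewrite rootE (horner_coef_wide _ szq) -[X in _ == X]cx; apply/eqP.
by apply: eq_bigr => j _; rewrite coef_map qE.
Qed.

(** The leading coefficient of an integer equation of [x] is a denominator
    of [x] at every place, and is not a unit where [x] has a pole. *)
Lemma place_denominator x : exists2 N : nat, (0 < N)%N & forall v, finite_place v ->
  valuation_ring v (N%:R * x) /\ (x != 0 -> v x < 0 -> valuation_ideal v N%:R).
Proof.
have [->|x0] := eqVneq x 0.
  by exists 1%N => // v vp; rewrite mulr0; split; first by left.
have [q q0 qx] := integer_polynomial x.
set m := (size q).-1; pose l := lead_coef q.
have szq : size q = m.+1 by rewrite /m prednK // lt0n size_poly_eq0.
have lE : l%:~R * x ^+ m = - \sum_(i < m) (q`_i)%:~R * x ^+ i.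
  have szm : (size (map_poly intr q : {poly K}) <= size q)%N by exact: size_poly.
  apply/eqP; rewrite -addr_eq0 addrC; apply/eqP.
  move: qx; rewrite rootE (horner_coef_wide _ szm) szq big_ord_recr /= => /eqP E;
    rewrite -[RHS]E.
  rewrite coef_map /l /lead_coef szq /=; congr (_ + _).
  by apply: eq_bigr => i _; rewrite coef_map.
have key v : finite_place v -> valuation_ring v (l%:~R * x) /\ (v x < 0 ->
  valuation_ideal v l%:~R).
  move=> vp; have ringO := subring_valuation_ring vp.
  have [vx|vx] := leP 0 (v x).
    by split=> //; apply: subringM => //; [apply: place_int|right].
  have Mx' : valuation_ideal v x^-1 by right; rewrite placeV //; lia.
  have Olx : valuation_ring v (l%:~R * x).
    case: m lE {szq} => [|n] lE.
      by move/eqP: lE; rewrite big_ord0 oppr0 mulr1 intr_eq0K lead_coef_eq0 (negPf q0).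
    have -> : l%:~R * x = (l%:~R * x ^+ n.+1) * x^-1 ^+ n.
      by rewrite -mulrA exprSr exprVn [_ * x]mulrC mulfK ?expf_neq0.
    rewrite lE mulNr mulr_suml; apply: subringN => //; apply: subring_sum => // i _.
    rewrite -mulrA; apply: subringM => //; first exact: place_int.
    have -> : x ^+ i * x^-1 ^+ n = x^-1 ^+ (n - i).
      by rewrite !exprVn expfB_cond ?(negPf x0) ?add0n -1?ltnS // invf_div.
    by apply: subringX => //; apply: ideal_valuation_ring.
  split=> // _; rewrite -[l%:~R](mulfK x0) mulrC.
  exact: valuation_idealM.
exists `|l|%N; first by rewrite absz_gt0 lead_coef_eq0.
move=> v vp; have [Olx Ml] := key v vp.
have lsgn : `|l|%N%:R = if l < 0 then - l%:~R else l%:~R :> K.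
  by case: (ltP l 0) => l0; rewrite pmulrn -?mulrNz; congr (_%:~R); lia.
rewrite lsgn; case: ifP => _; last by split=> // _.
rewrite mulNr; split; first by apply: subringN => //; apply: subring_valuation_ring.
by move=> _ /Ml; apply: valuation_idealN.
Qed.

Lemma valuation_ideal_prime_divisor v n : finite_place v -> (0 < n)%N ->
  valuation_ideal v n%:R ->
  exists2 p, p \in primes n & valuation_ideal v p%:R.
Proof.
move=> vp; elim/ltn_ind: n => n IHn n0 Mn.
have n1 : (1 < n)%N.
  by case: n n0 Mn {IHn} => [|[|n]] // _ /(valuation_ideal1 vp).
have p_pr := pdiv_prime n1; set p := pdiv n in p_pr.
have [Mp|nMp] := pselect (valuation_ideal v p%:R).
  by exists p => //; rewrite mem_primes p_pr n0 pdiv_dvd.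
have /dvdnP[k nE] := pdiv_dvd n; rewrite -/p in nE.
have k0 : (0 < k)%N by move: n0; rewrite nE muln_gt0 => /andP[].
have kn : (k < n)%N by rewrite nE ltn_Pmulr // prime_gt1.
have [|r rk Mr] := IHn k kn k0; last first.
  by exists r => //; move: rk; rewrite !mem_primes n0 => /and3P[-> _ rk];
    rewrite nE dvdn_mulr.
have p0 : (p%:R : K) != 0 by rewrite natr_eq0K -lt0n prime_gt0.
have [/eqP|vk] := Mn; first by rewrite natr_eq0K -leqn0 leqNgt n0.
right; move: vk; rewrite nE natrM placeM // ?natr_eq0K -?lt0n //.
suff -> : v p%:R = 0 by rewrite addr0.
apply/eqP; rewrite eq_le; apply/andP; split.
  by rewrite leNgt; apply/negP => vp0; apply: nMp; right.
by have [/eqP|//] := place_int vp p; rewrite (negPf p0).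
Qed.

Lemma negative_places_finite x : finite_set [set v | finite_place v /\ x != 0 /\ v x < 0].
Proof.
have [N N0 HN] := place_denominator x.
apply: (@sub_finite_set _ _ (\bigcup_(p in [set` primes N]) (@places_over K p : set (K ->
  int)))).
  move=> v [vp [x0 vx]]; have [_ /(_ x0 vx) MN] := HN v vp.
  have [p pN Mp] := valuation_ideal_prime_divisor vp N0 MN; exists p => //; split=> //.
  case: Mp => // /eqP; rewrite natr_eq0K => /eqP p0.
  by move: pN; rewrite p0 mem_primes.
apply: bigcup_finite; first exact: finite_seq.
by move=> p /=; rewrite mem_primes => /and3P[p_pr _ _]; apply: places_over_finite.
Qed.

Lemma integral_of_places x : (forall v, finite_place v -> valuation_ring v x) -> integral x.
Proof.
move=> Ox; apply: contrapT => /nonintegral_place[v vp vx].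
have [x0|] := Ox v vp; last by lia.
by move: vx; rewrite x0; have [-> _ _ _] := vp.
Qed.

Lemma integral_denominator x : exists2 N : nat, (0 < N)%N & integral (N%:R * x).
Proof.
have [N N0 HN] := place_denominator x; exists N => //; apply: integral_of_places => v vp.
by case: (HN v vp).
Qed.

Variable R : realType.

(** Finiteness of the support matters: a product with infinite support is [1]
    by convention. *)
Lemma prod_le_fsbig (T : choiceType) (S : set T) (F : T -> R) (s : seq T) :
  (forall t, S t -> 1 <= F t) -> finite_set (S `&` [set t | F t != 1]) ->
  uniq s -> (forall t, t \in s -> S t) ->
  \prod_(t <- s) F t <= \big[*%R/1]_(t \in S) F t.
Proof.
move=> F1 fin us sS.
have fin' : finite_set (S `&` F @^-1` [set~ 1]).
  by apply: sub_finite_set fin => t [St /= Ft]; split=> //=; apply/eqP.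
have memr t : (t \in finite_support 1 S F) = (t \in S `&` F @^-1` [set~ 1]).
  exact: in_finite_support.
set r := finite_support 1 S F in memr *.
rewrite [leRHS](bigID (fun t => t \in s)) /=.
have -> : \prod_(t <- s) F t = \prod_(i <- r | i \in s) F i.
  rewrite (bigID (fun t => t \in r)) /= [X in _ * X]big1_seq ?mulr1; last first.
    move=> t /andP[tr ts]; apply: contrapT => Ft; case/negP: tr.
    by rewrite memr inE; split; [apply: sS|].
  rewrite -big_filter -[RHS]big_filter; apply: perm_big; apply: uniq_perm.
  - exact: filter_uniq.
  - by apply: filter_uniq; apply: finite_support_uniq.
  - by move=> t; rewrite !mem_filter andbC.
rewrite ler_peMr //.
  rewrite big_seq_cond; apply: prodr_ge0 => t /andP[_ ts].
  by apply: le_trans (F1 _ (sS _ ts)); rewrite ler01.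
rewrite big_seq_cond; elim/big_rec: _ => // t u /andP[tr _] u1.
have St : S t by move: tr; rewrite memr inE => -[].
by rewrite -[1]mulr1 ler_pM // F1.
Qed.

(** An embedding is determined by the images of the elements of a basis, which
    are roots of fixed integer polynomials. *)
Lemma complex_embedding_finite : finite_set (@complex_embedding R K).
Proof.
pose e (i : 'I_(\dim {:K})) := (vbasis {:K})`_i.
have /choice[q qE] i : exists q : {poly int}, q != 0 /\ root (map_poly intr q) (e i).
  by have [q q0 qe] := integer_polynomial (e i); exists q.
have [rs Hrs] : exists rs : seq R[i], forall (f : {rmorphism K -> R[i]}) i, f (e i) \in rs.
  have /choice[rs Hrs] i : exists rs : seq R[i], forall f : {rmorphism K ->
    R[i]}, f (e i) \in rs.
    have [q0 qe] := qE i; pose Q : {poly R[i]} := map_poly intr (q i).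
    have [rs QE] := closed_field_poly_normal Q; exists rs => f.
    have : root Q (f (e i)).
      have -> : Q = map_poly f (map_poly intr (q i)).
        by rewrite -map_poly_comp; apply: eq_map_poly => a /=; rewrite rmorph_int.
      by rewrite fmorph_root.
    rewrite QE rootZ ?root_prod_XsubC // lead_coef_eq0 map_poly_eq0_id0 //.
    by rewrite intr_eq0 lead_coef_eq0.
  exists (flatten [seq rs i | i : 'I_(\dim {:K})]) => f i.
  by apply/flattenP; exists (rs i) => //; apply: map_f; rewrite mem_enum.
apply: (@finite_injective_on _ {ffun 'I_(\dim {:K}) -> 'I_(size rs).+1} _
   (fun f => [ffun i => inord (index (f (e i)) rs)])) => _ _ [f _ <-] [g _ <-].
move=> /ffunP fg; apply/funext => x.
have eqe i : f (e i) = g (e i).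
  have := fg i; rewrite !ffunE => /(congr1 val) /=.
  rewrite !inordK ?ltnS ?index_size // => E.
  by rewrite -[LHS](nth_index 0 (Hrs f i)) E nth_index.
rewrite (coord_vbasis (memvf x)) !rmorph_sum; apply: eq_bigr => i _.
rewrite -mulr_algl !rmorphM /= -/(e i) eqe; congr (_ * _).
have alg_rat (h : {rmorphism K -> R[i]}) (a : rat) : h a%:A = ratr a.
  by rewrite -[LHS]/((h \o in_alg K) a) fmorph_eq_rat.
by rewrite !alg_rat.
Qed.

Section Point.
Variables (m : nat) (x : 'rV[K]_m) (j0 : 'I_m).
Hypothesis xj0 : x 0 j0 = 1.
Local Notation d := (\dim {:K}).

Let arch (f : K -> R[i]) := \big[Num.max/0]_(j < m) ComplexField.Normc.normc (f (x 0 j)).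
Let nonarch v := \big[Num.max/0]_(j < m) finite_norm R v (x 0 j).

Let arch_ge1 f : complex_embedding f -> 1 <= arch f.
Proof.
move=> [g _ <-]; apply: le_trans (le_bigmax _ _ j0).
by rewrite xj0 rmorph1 /ComplexField.Normc.normc /= expr0n expr1n addr0 sqrtr1.
Qed.

Let nonarch_ge1 v : finite_place v -> 1 <= nonarch v.
Proof.
move=> vp; apply: le_trans (le_bigmax _ _ j0).
by rewrite xj0 /finite_norm oner_eq0 place1 // oppr0 expr0z.
Qed.

Let nonarch_finite : finite_set (@finite_place K `&` [set v | nonarch v != 1]).
Proof.
apply: (@sub_finite_set _ _ (\bigcup_(j in [set: 'I_m]) [set v | finite_place v /\ x 0 j != 0 /\ v (x 0 j) < 0])).
  move=> v [vp /= Fv]; apply: contrapT => none; case/negP: Fv.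
  rewrite eq_le nonarch_ge1 // andbT; apply: bigmax_le => // j _.
  rewrite /finite_norm; case: eqVneq => [//|xj]; have [vx|vx] := leP 0 (v (x 0 j));
    last first.
    by case: none; exists j.
  rewrite -invr_expz; case: (v (x 0 j)) vx => // n _.
  rewrite -exprnP -natrX; case: (_ ^ n)%N => [|k]; first by rewrite invr0.
  by rewrite invf_le1 // ler1n.
by apply: bigcup_finite => [|j _]; [apply: finite_finset|apply: negative_places_finite].
Qed.

Let arch_finite : finite_set (@complex_embedding R K `&` [set f | arch f != 1]).
Proof. by apply: sub_finite_set complex_embedding_finite => f []. Qed.

Let arch_prod_ge1 : 1 <= \big[*%R/1]_(f \in @complex_embedding R K) arch f.
Proof. by apply: le_trans (@prod_le_fsbig _ _ _ [::] arch_ge1 arch_finite _ _);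
  rewrite ?big_nil. Qed.
Let nonarch_prod_ge1 : 1 <= \big[*%R/1]_(v \in @finite_place K) nonarch v.
Proof. by apply: le_trans (@prod_le_fsbig _ _ _ [::] nonarch_ge1 nonarch_finite _ _);
  rewrite ?big_nil. Qed.

Let heightX : weil_height R x ^+ d =
  (\big[*%R/1]_(f \in @complex_embedding R K) arch f) * (\big[*%R/1]_(v \in @finite_place K) nonarch v).
Proof.
rewrite /weil_height -powR_mulrn ?powR_ge0 // -powRrM mulVf ?powRr1 //.
  by apply: mulr_ge0; apply: le_trans ler01 _.
by rewrite pnatr_eq0 -lt0n adim_gt0.
Qed.

Lemma weil_height_ge1 : 1 <= weil_height R x ^+ d.
Proof. by rewrite heightX mulr_ege1. Qed.

Lemma weil_height_norm (f : {rmorphism K -> R[i]}) j :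
  ComplexField.Normc.normc (f (x 0 j)) <= weil_height R x ^+ d.
Proof.
apply: (@le_trans _ _ (arch f)); first exact: (le_bigmax _ (fun j =>
  ComplexField.Normc.normc (f (x 0 j)))).
rewrite heightX; apply: (@le_trans _ _ (\big[*%R/1]_(f \in @complex_embedding R K) arch f)).
  have := @prod_le_fsbig _ _ _ [:: f : K -> R[i]] arch_ge1 arch_finite isT.
  by rewrite big_seq1; apply => g; rewrite inE => /eqP->; exists f.
by rewrite ler_peMr // (le_trans ler01).
Qed.

(** For [D] minimal and a prime [p] dividing [D], some place over [p] rules
    out [D / p] as a denominator, so contributes at least [p ^ logn p D]. *)
Lemma weil_height_denominator : exists D : nat,
  [/\ (0 < D)%N, D%:R <= weil_height R x ^+ d & forall j, integral (D%:R * x 0 j)].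
Proof.
have exD : exists D, `[< (0 < D)%N /\ forall j, integral (D%:R * x 0 j) >].
  have /choice[N HN] j : exists N : nat, (0 < N)%N /\ integral (N%:R * x 0 j).
    by have [N N0 Nx] := integral_denominator (x 0 j); exists N.
  exists (\prod_j N j)%N; apply/asboolP; split; first by apply: prodn_gt0 => j;
    case: (HN j).
  move=> j; rewrite (bigD1 j) //= mulnC natrM -mulrA; apply: integral_mul;
    last by case: (HN j).
  exact: integral_nat.
have [D /asboolP[D0 Dx] minD] := ex_minnP exD; exists D; split=> //.
have place p : exists v, p \in primes D -> [/\ finite_place v, valuation_ideal v p%:R & (p ^ logn p D)%:R <= nonarch v].
  have [pD|npD] := boolP (p \in primes D); last by exists (fun=> 0).
  move: pD; rewrite mem_primes => /and3P[p_pr _ pD].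
  set D' := (D %/ p)%N; have DE : D = (D' * p)%N by rewrite divnK.
  have p0 : (0 < p)%N by apply: prime_gt0.
  have D'0 : (0 < D')%N by rewrite divn_gt0 // dvdn_leq.
  have [j nj] : exists j, ~ integral (D'%:R * x 0 j).
    apply/existsNP => alli; have : (D <= D')%N by apply: minD; apply/asboolP.
    by rewrite leqNgt DE ltn_Pmulr // prime_gt1.
  have [v vp vDx] := nonintegral_place nj; exists v => _.
  have xj : x 0 j != 0.
    by apply: contra_not_neq nj => ->; rewrite mulr0; apply: integral0.
  have pK : (p%:R : K) != 0 by rewrite natr_eq0K -lt0n.
  have D'K : (D'%:R : K) != 0 by rewrite natr_eq0K -lt0n.
  have vDxj : 0 <= v (D'%:R) + v (p%:R) + v (x 0 j).
    have := integral_place vp (Dx j); rewrite DE natrM.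
    case=> [/eqP|]; first by rewrite !mulf_eq0 (negPf pK) (negPf D'K) (negPf xj).
    by rewrite !placeM // mulf_neq0.
  move: vDx; rewrite placeM // => vDx.
  have vp0 : 0 < v p%:R by lia.
  have Mp : valuation_ideal v p%:R by right.
  split=> //.
  have lD : logn p D = (logn p D').+1 by rewrite {1}DE lognM //
    [X in (_ + X)%N]logn_prime // eqxx addn1.
  have vD' : (logn p D')%:Z <= v D'%:R.
    rewrite -{2}(partnC p D'0) p_part natrM natrX placeM ?expf_neq0 //;
      last by rewrite natr_eq0K -lt0n part_gt0.
    rewrite placeX //; have [/eqP|] := place_int vp (D'`_p^')%N;
      first by rewrite natr_eq0K -leqn0 leqNgt part_gt0.
    rewrite -pmulrn; have : (logn p D')%:Z <= v p%:R * (logn p D') by move: vp0;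
      move: (v _) (logn _ _) => a b; nia.
    by move=> h1 h2; apply: (le_trans h1); rewrite lerDl.
  have q_ge := residue_card_ge vp p_pr Mp.
  apply: (@le_trans _ _ (finite_norm R v (x 0 j)));
    last exact: (le_bigmax _ (fun j => finite_norm R v (x ord0 j))).
  rewrite /finite_norm (negPf xj).
  have -> : - v (x 0 j) = `|(v (x 0 j))%R|%N by lia.
  rewrite -exprnP -natrX ler_nat; apply: (@leq_trans (residue_card v ^ logn p D)).
    by rewrite leq_exp2r // lD.
  rewrite leq_pexp2l //; last by rewrite lD; lia.
  exact: leq_trans q_ge.
have [v Hv] := choice place.
rewrite heightX; apply: (@le_trans _ _ (\big[*%R/1]_(v \in @finite_place K) nonarch v));
  last first.
  by rewrite ler_peMl // (le_trans ler01).
apply: le_trans (@prod_le_fsbig _ _ _ [seq v p | p <- primes D] nonarch_ge1 nonarch_finite _ _).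
- rewrite big_map {1}(prod_prime_decomp D0) prime_decompE big_map /= natr_prod.
  rewrite big_seq [X in _ <= X]big_seq; apply: ler_prod => p /Hv[_ _ ->].
  by rewrite ler0n.
- rewrite map_inj_in_uniq ?primes_uniq // => p r pD rD vpr.
  have [vp Mp _] := Hv p pD; have [_ Mr _] := Hv r rD; rewrite -vpr in Mr.
  move: pD rD; rewrite !mem_primes => /and3P[p_pr _ _] /and3P[r_pr _ _].
  apply/eqP; rewrite -dvdn_prime2 //; apply: contrapT => /negP npr.
  exact: (@place_int_coprime _ _ vp p r).
- by move=> _ /mapP[p /Hv[vp _ _] ->].
Qed.

End Point.
End Heights.

(** * The regular representation and complex embeddings *)

Section RegularRepresentation.
Import VectorInternalTheory.
Variable K : fieldExtType rat.
Local Notation d := (dim K).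
Implicit Types x y : K.

(** The matrix of multiplication by [x] on the rational vector space [K]. *)
Definition reg_mx x : 'M[rat]_d := \matrix_i v2r (r2v (delta_mx 0 i) * x).

Lemma mul_reg_mx (u : 'rV_d) x : u *m reg_mx x = v2r (r2v u * x).
Proof.
rewrite mulmx_sum_row [in RHS](row_sum_delta u) linear_sum mulr_suml linear_sum.
by apply: eq_bigr => i _; rewrite rowK linearZ /= -scalerAl linearZ.
Qed.

Let reg_ext (A B : 'M[rat]_d) : (forall u : 'rV_d, u *m A = u *m B) -> A = B.
Proof. by move=> AB; apply/row_matrixP => i; rewrite !rowE AB. Qed.

Lemma reg_mxM x y : reg_mx (x * y) = reg_mx x *m reg_mx y.
Proof. by apply: reg_ext => u; rewrite mulmxA !mul_reg_mx v2rK mulrA. Qed.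

Lemma reg_mxD x y : reg_mx (x + y) = reg_mx x + reg_mx y.
Proof. by apply: reg_ext => u; rewrite mulmxDr !mul_reg_mx mulrDr linearD. Qed.

Lemma reg_mxZ a x : reg_mx (a *: x) = a *: reg_mx x.
Proof. by apply: reg_ext => u; rewrite -scalemxAr !mul_reg_mx -scalerAr linearZ. Qed.

Lemma reg_mx1 : reg_mx 1 = 1%:M.
Proof. by apply: reg_ext => u; rewrite mul_reg_mx mulr1 r2vK mulmx1. Qed.

Lemma dim_field_gt0 : (0 < d)%N.
Proof. by rewrite -dimvf adim_gt0. Qed.

(** The characteristic polynomial of [x] over the rationals; its complex roots
    are the images of [x] under the embeddings of [K]. *)
Definition reg_poly x := char_poly (reg_mx x).

Lemma size_reg_poly x : size (reg_poly x) = d.+1.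
Proof. exact: size_char_poly. Qed.

Lemma reg_poly_monic x : reg_poly x \is monic.
Proof. exact: char_poly_monic. Qed.

(** The basis vectors form a column eigenvector of [reg_mx x] over [K]. *)
Lemma root_reg_poly_in x : root (map_poly (in_alg K) (reg_poly x)) x.
Proof.
rewrite /reg_poly map_char_poly; set A := map_mx _ _.
pose w : 'cV[K]_d := \col_i r2v (delta_mx 0 i).
have Aw : (x%:M - A) *m w = 0.
  apply/colP => i; rewrite mulmxBl mul_scalar_mx !mxE.
  apply/eqP; rewrite subr_eq0; apply/eqP.
  rewrite mulrC -[LHS]v2rK -mul_reg_mx -rowE (row_sum_delta (row i _)) linear_sum.
  by apply: eq_bigr => j _; rewrite linearZ !mxE /= mulr_algl.
have w0 : w != 0.
  have i0 : 'I_d := Ordinal dim_field_gt0.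
  apply/eqP => /colP/(_ i0); rewrite !mxE => /(congr1 v2r).
  rewrite r2vK linear0 => /rowP/(_ i0)/eqP.
  by rewrite !mxE !eqxx oner_eq0.
have det0 : \det (x%:M - A) = 0.
  apply/eqP; apply: contraNT w0 => detA.
  have U : (x%:M - A) \in unitmx by rewrite unitmxE unitfE.
  by rewrite -[w](mulKmx U) Aw mulmx0.
have /eqP/det0P[v v0 vA] := det0; rewrite -eigenvalue_root_char.
apply/eigenvalueP; exists v => //; apply/esym/eqP.
by rewrite -subr_eq0 -mul_mx_scalar -mulmxBr vA.
Qed.

Variable C : numClosedFieldType.

Lemma root_reg_poly (f : {rmorphism K -> C}) x : root (map_poly ratr (reg_poly x)) (f x).
Proof.
have -> : map_poly ratr (reg_poly x) = map_poly f (map_poly (in_alg K) (reg_poly x)).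
  rewrite -map_poly_comp; apply: eq_map_poly => a /=.
  exact/esym/(fmorph_eq_rat (f \o in_alg K)).
by rewrite fmorph_root root_reg_poly_in.
Qed.

(** The commuting matrices [reg_mx y] have a common eigenvector in the
    eigenspace of [reg_mx x] for [z]; its eigenvalues define an embedding. *)
Lemma embedding_of_root x z : root (map_poly ratr (reg_poly x)) z ->
  exists f : {rmorphism K -> C}, f x = z.
Proof.
pose M y : 'M[C]_d := map_mx ratr (reg_mx y).
have MM a b : M (a * b) = M a *m M b by rewrite /M reg_mxM map_mxM.
have MD a b : M (a + b) = M a + M b by rewrite /M reg_mxD map_mxD.
have MZ a b : M (a *: b) = ratr a *: M b by rewrite /M reg_mxZ map_mxZ.
have M1 : M 1 = 1%:M by rewrite /M reg_mx1 map_mx1.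
have Mcomm a b : comm_mx (M a) (M b) by rewrite /comm_mx -!MM mulrC.
rewrite /reg_poly map_char_poly -/(M x) -eigenvalue_root_char => eig.
set V := eigenspace (M x) z.
have stV y : stablemx V (M y) by apply: comm_mx_stable_eigenspace.
have [||v v0 /allP vP] := @common_eigenvector C _ [seq restrictmx V (M e) | e <- vbasis {:K}].
- by rewrite lt0n mxrank_eq0.
- move=> _ _ /mapP[a _ ->] /mapP[b _ ->].
  rewrite /comm_mx -!conjmxM ?inE ?stablemx_row_base ?stV //.
  by rewrite (Mcomm a b).
pose u := v *m row_base V.
have u0 : u != 0 by rewrite mulmx_free_eq0 ?row_base_free.
have Hu y : exists a, u *m M y = a *: u.
  have He i : exists a, u *m M (vbasis {:K})`_i = a *: u.
    have [lti|gei] := ltnP i (size (vbasis {:K})); last first.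
      exists 0; rewrite (nth_default _ gei) -(scale0r 0) MZ rmorph0 !scale0r mulmx0 //.
    have : stablemx u (M (vbasis {:K})`_i).
      rewrite -stablemx_restrict ?stV //.
      by apply: vP; apply: (map_f (fun e => restrictmx V (M e))); apply: mem_nth.
    by move=> /eigenvectorP[a /eigenspaceP ua]; exists a.
  have /choice[a Ha] := He.
  exists (\sum_(i < \dim {:K}) ratr (coord (vbasis {:K}) i y) * a i).
  rewrite {1}(coord_vbasis (memvf y)).
  have Msum (I : Type) (r : seq I) (E : I -> K) : M (\sum_(i <- r) E i) = \sum_(i <- r) M (E i).
    apply: big_morph => [b c|]; first exact: MD.
    by rewrite -(scale0r 0) MZ rmorph0 scale0r.
  rewrite Msum mulmx_sumr scaler_suml; apply: eq_bigr => i _.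
  by rewrite MZ -scalemxAr Ha scalerA.
have /choice[f Hf] := Hu.
have finj a b : a *: u = b *: u -> a = b.
  by move=> ab; apply/eqP; rewrite -subr_eq0 -[_ == _]orbF -(negPf u0) -scalemx_eq0 scalerBl ab subrr.
have fB : {morph f : a b / a - b}.
  move=> a b; apply: finj; rewrite -Hf scalerBl -!Hf -mulmxBr; congr (_ *m _).
  by rewrite -scaleN1r MD MZ rmorphN1 scaleN1r.
have fM : {morph f : a b / a * b}.
  by move=> a b; apply: finj; rewrite -Hf MM mulmxA Hf -scalemxAl Hf scalerA.
have f1 : f 1 = 1 by apply: finj; rewrite -Hf M1 mulmx1 scale1r.
pose f' : {rmorphism K -> C} := HB.pack f
  (GRing.isZmodMorphism.Build K C f fB) (GRing.isMonoidMorphism.Build K C f (conj f1 fM)).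
exists f' => /=; apply: finj; rewrite -Hf.
suff /eigenspaceP : (u <= V)%MS by [].
by apply: mulmx_sub; rewrite eq_row_base.
Qed.

Lemma embedding_exists : exists f : {rmorphism K -> C}, True.
Proof.
have [z rz] : exists z, root (map_poly ratr (reg_poly 1)) (z : C).
  by apply/closed_rootP; rewrite size_map_poly size_reg_poly eqSS -lt0n dim_field_gt0.
by have [f _] := embedding_of_root rz; exists f.
Qed.

Lemma reg_poly_split x : exists zs : seq C,
  [/\ map_poly ratr (reg_poly x) = \prod_(z <- zs) ('X - z%:P), size zs = d &
      forall z, z \in zs -> exists f : {rmorphism K -> C}, f x = z].
Proof.
have [zs E] := closed_field_poly_normal (map_poly ratr (reg_poly x) : {poly C}).
rewrite lead_coef_map (monicP (reg_poly_monic x)) rmorph1 scale1r in E.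
exists zs; split=> // [|z zzs].
  by apply/eqP; rewrite -eqSS -(size_prod_XsubC zs id) -E size_map_poly size_reg_poly.
by apply: embedding_of_root; rewrite E root_prod_XsubC.
Qed.

End RegularRepresentation.

(** * Algebraic integers and products of linear factors *)

Section Integrality.

Lemma integral_fmorph (F G : fieldType) (f : {rmorphism F -> G}) x :
  integral (f x) <-> integral x.
Proof.
have E (q : {poly int}) : map_poly intr q = map_poly f (map_poly intr q).
  by rewrite -map_poly_comp; apply: eq_map_poly => a /=; rewrite rmorph_int.
by split=> -[q mq qx]; exists q => //; move: qx; rewrite E fmorph_root.
Qed.

Lemma integral_int (F : fieldType) (a : int) : integral (a%:~R : F).
Proof. exact: integral_id. Qed.

Lemma integral_sum (F : fieldType) (I : Type) (r : seq I) (P : pred I) (E : I -> F) :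
  (forall i, P i -> integral (E i)) -> integral (\sum_(i <- r | P i) E i).
Proof. by move=> IE; apply: big_ind => //; [apply: integral0|apply: integral_add]. Qed.

Lemma integral_prod (F : fieldType) (I : Type) (r : seq I) (P : pred I) (E : I -> F) :
  (forall i, P i -> integral (E i)) -> integral (\prod_(i <- r | P i) E i).
Proof. by move=> IE; apply: big_ind => //; [apply: integral1|apply: integral_mul]. Qed.

Lemma integral_exp (F : fieldType) (x : F) n : integral x -> integral (x ^+ n).
Proof. by move=> Ix; rewrite -[n]card_ord -prodr_const; apply: integral_prod. Qed.

Lemma integral_monic_root (F : fieldType) (p : {poly F}) x :
  p \is monic -> (forall i, integral p`_i) -> root p x -> integral x.
Proof. by move=> mp Ip px; apply: integral_root_monic mp px _; apply/integral_poly. Qed.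

Lemma integral_of_exp (F : fieldType) (x : F) n : (0 < n)%N -> integral (x ^+ n) ->
  integral x.
Proof.
move=> n0 Ix; apply: (@integral_monic_root _ ('X^n - (x ^+ n)%:P)).
- by rewrite monicE lead_coefDl ?lead_coefXn // size_polyN size_polyXn size_polyC;
  case: eqP; lia.
- move=> i; rewrite coefB coefXn coefC; apply: integral_sub; case: eqP => _ //.
  + exact: integral1. + exact: integral0. + exact: integral0.
- by rewrite rootE !hornerE subrr.
Qed.

Lemma integral_rat (F : fieldType) (f : {rmorphism rat -> F}) (a : rat) :
  integral (f a) -> exists z : int, a = z%:~R.
Proof.
move=> /(integral_fmorph f)/(integral_fmorph (ratr : rat -> algC))[q mq qa].
have Aa : (ratr a : algC) \in Aint.
  apply: (root_monic_Aint qa); first exact: monic_map.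
  by apply/polyOverP => i; rewrite coef_map /= rpred_int.
have /intrP[z az] := Cint_rat_Aint (Crat_rat a) Aa.
by exists z; apply: (fmorph_inj (ratr : rat -> algC)); rewrite /= az rmorph_int.
Qed.

(** The [k]-th power of the denominator of [c] divides [b]. *)
Lemma rat_exp_int (b k : nat) (c : rat) (z : int) : (0 < b < 2 ^ k)%N ->
  b%:R * c ^+ k = z%:~R -> exists a : int, c = a%:~R.
Proof.
move=> /andP[b0 bk]; case: (ratP c) => n e cne E.
exists n; suff -> : e = 0%N by rewrite divr1.
have e0 : (e.+1%:R : rat) != 0 by rewrite pnatr_eq0.
have Ez : b%:Z * n ^+ k = z * e.+1%:Z ^+ k.
  apply: (@intr_inj rat); rewrite !intrM !rmorphXn /= -E.
  by rewrite expr_div_n -mulrA divfK ?expf_neq0 // pmulrn.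
have cop : coprime (e.+1 ^ k) (`|n| ^ k) by rewrite coprimeXl // coprimeXr // coprime_sym.
have : (e.+1 ^ k %| b * `|n| ^ k)%N.
  have /(congr1 absz) := Ez; rewrite !abszM !abszX /= => ->.
  exact: dvdn_mull.
rewrite Gauss_dvdl // => /(dvdn_leq b0) le.
have := leq_ltn_trans le bk; case: k {E Ez cop le bk} => // k.
by rewrite ltn_exp2r //; lia.
Qed.

End Integrality.

Section RootProducts.

Lemma integral_prod_XsubC (F : fieldType) (rs : seq F) :
  (forall r, r \in rs -> integral r) -> forall i, integral (\prod_(r <- rs) ('X - r%:P))`_i.
Proof.
elim: rs => [|r rs IHrs] Irs i.
  by rewrite big_nil coef1; case: eqP => _; [apply: integral1|apply: integral0].
have {}IHrs := IHrs (fun x xrs => Irs x (@mem_behead _ (r :: rs) _ xrs)).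
rewrite big_cons mulrBl coefB coefXM coefCM; apply: integral_sub.
  by case: ifP => _ //; apply: integral0.
by apply: integral_mul => //; apply: Irs; rewrite mem_head.
Qed.

Lemma norm_coef_prod_XsubC (C : numDomainType) (rs : seq C) (Y : C) : 0 <= Y ->
  (forall r, r \in rs -> `|r| <= Y) ->
  forall i, `|(\prod_(r <- rs) ('X - r%:P))`_i| <= (1 + Y) ^+ size rs.
Proof.
move=> Y0; elim: rs => [|r rs IHrs] Yrs i.
  by rewrite big_nil coef1 expr0; case: eqP; rewrite ?normr1 ?normr0 ?ler01.
have {}IHrs := IHrs (fun x xrs => Yrs x (@mem_behead _ (r :: rs) _ xrs)).
rewrite big_cons mulrBl coefB coefXM coefCM /= exprS mulrDl mul1r.
apply: le_trans (ler_normB _ _) _; apply: lerD.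
  by case: ifP => _ //; rewrite normr0 exprn_ge0 // addr_ge0.
by rewrite normrM ler_pM // Yrs // mem_head.
Qed.

Lemma coef_prod_XsubC_scale (F : comNzRingType) (rs : seq F) (a : F) i :
  (\prod_(r <- rs) ('X - (a * r)%:P))`_i * a ^+ i =
  a ^+ size rs * (\prod_(r <- rs) ('X - r%:P))`_i.
Proof.
elim: rs i => [|r rs IHrs] i.
  by rewrite !big_nil !coef1; case: i => [|i]; rewrite /= ?mul0r ?mulr0 ?mulr1.
rewrite !big_cons !mulrBl !coefB !coefXM !coefCM /= exprS mulrBl mulrBr.
congr (_ - _); last by rewrite -[a * r * _ * _]mulrA IHrs; ring.
case: i => [|i] /=; first by rewrite mul0r mulr0.
by rewrite exprS mulrCA IHrs mulrA.
Qed.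

(** With [delta ^+ k = D], the roots scaled by [delta] are integral. *)
Lemma integral_coef_exp (C : numClosedFieldType) (rs : seq C) (D k : nat) :
  (0 < D)%N -> (0 < k)%N -> (forall r, r \in rs -> integral (D%:R * r ^+ k)) ->
  forall i, integral (D%:R ^+ size rs * (\prod_(r <- rs) ('X - r%:P))`_i ^+ k).
Proof.
move=> D0 k0 Irs i; set c := _`_i.
have [irs|rsi] := leqP i (size rs); last first.
  by rewrite /c nth_default ?size_prod_XsubC // expr0n eqn0Ngt k0 mulr0; apply: integral0.
pose delta := k.-root (D%:R : C); have deltaK : delta ^+ k = D%:R by apply: rootCK.
have Ic : integral (\prod_(r <- [seq delta * r | r <- rs]) ('X - r%:P))`_i.
  apply: integral_prod_XsubC => _ /mapP[r rrs ->].
  by apply: (integral_of_exp k0); rewrite exprMn deltaK; apply: Irs.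
rewrite big_map in Ic; set c' := _`_i in Ic.
have E : D%:R ^+ size rs * c ^+ k = c' ^+ k * D%:R ^+ i.
  have /(congr1 (fun x => x ^+ k)) := coef_prod_XsubC_scale rs delta i.
  by rewrite !exprMn -!exprM ![(_ * k)%N]mulnC !exprM deltaK => ->.
by rewrite E; apply: integral_mul; apply: integral_exp => //; apply: integral_nat.
Qed.

Lemma roots_finite (F : fieldType) (p : {poly F}) : p != 0 ->
  exists rs : seq F, forall x, root p x -> x \in rs.
Proof.
elim: {p}(size p) {-2}p (leqnn (size p)) => [|n IHn] p.
  by rewrite leqn0 size_poly_eq0 => ->.
move=> szp p0; have [[x px]|nox] := pselect (exists x, root p x); last first.
  by exists [::] => x px; case: nox; exists x.
have /factor_theorem[q pq] := px.
have q0 : q != 0 by apply: contraNneq p0 => q0; rewrite pq q0 mul0r.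
have [|rs Hrs] := IHn q _ q0.
  by move: szp; rewrite pq size_Mmonic ?monicXsubC // size_XsubC addn2.
exists (x :: rs) => y; rewrite pq rootM root_XsubC inE => /orP[/Hrs->|->] //.
by rewrite orbT.
Qed.

End RootProducts.

(** * Small denominators, and finiteness of bounded integers *)

Lemma prod_norm_le (C : numDomainType) (zs : seq C) (Y : C) :
  (forall z, z \in zs -> `|z| <= Y) -> \prod_(z <- zs) `|z| <= Y ^+ size zs.
Proof.
elim: zs => [|z zs IHzs] zY; first by rewrite big_nil.
rewrite big_cons /= exprS ler_pM ?prodr_ge0 ?zY ?mem_head // IHzs // => w wzs.
by rewrite zY // inE wzs orbT.
Qed.

Section FieldIntegers.
Variables (K : fieldExtType rat) (C : numClosedFieldType).
Local Notation d := (dim K).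
Implicit Types x y : K.

(** [Y] bounds the house of [x], the largest absolute value of its conjugates. *)
Definition house_le (Y : nat) x := forall f : {rmorphism K -> C}, `|f x| <= Y%:R.

Lemma integral_reg_poly x : integral x -> forall i, exists a : int, (reg_poly x)`_i = a%:~R.
Proof.
move=> Ix i; have [zs [E _ Hz]] := reg_poly_split C x.
apply: (integral_rat (f := ratr : {rmorphism rat -> C})).
rewrite /= -coef_map E; apply: integral_prod_XsubC => z /Hz[f <-].
exact/integral_fmorph.
Qed.

Lemma integral_of_reg_poly x : (forall i, exists a : int, (reg_poly x)`_i = a%:~R) ->
  integral x.
Proof.
move=> Ha; apply: (integral_monic_root _ _ (root_reg_poly_in x)).
  by rewrite monic_map // reg_poly_monic.
by move=> i; rewrite coef_map; have [a ->] := Ha i; rewrite /= scaler_int;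
  apply: integral_int.
Qed.

(** A prime in the denominator of [x] would occur to a power of about
    [k / [K : Q]] in [D]; the proof avoids primes by applying
    [integral_coef_exp] to the conjugates of [x]. *)
Lemma integral_of_small_denominator x (D k : nat) : (0 < D)%N ->
  (D ^ d < 2 ^ k)%N -> integral (D%:R * x ^+ k) -> integral x.
Proof.
move=> D0 Dk Ix.
have k0 : (0 < k)%N by move: Dk; case: k {Ix} => //; rewrite ltnS leqNgt expn_gt0 D0.
apply: integral_of_reg_poly => i.
have [zs [E szs Hz]] := reg_poly_split C x.
have : integral (D%:R ^+ size zs * (\prod_(z <- zs) ('X - z%:P))`_i ^+ k).
  apply: integral_coef_exp => // z /Hz[f <-].
  have -> : D%:R * f x ^+ k = f (D%:R * x ^+ k) by rewrite rmorphM rmorphXn rmorph_nat.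
  exact/integral_fmorph.
rewrite szs -E coef_map /= => H.
have {}H : integral ((ratr : {rmorphism rat -> C}) ((D ^ d)%:R * (reg_poly x)`_i ^+ k)).
  by rewrite natrX rmorphM !rmorphXn /= ratr_nat.
have [z zE] := integral_rat H.
by apply: rat_exp_int zE; rewrite expn_gt0 D0 Dk.
Qed.

(** Northcott's finiteness: the coefficients of [reg_poly x] are bounded
    rational integers. *)
Lemma northcott (Y : nat) : exists S : seq K,
  forall x, integral x -> house_le Y x -> x \in S.
Proof.
pose N := ((1 + Y) ^ d)%N.
pose P (a : {ffun 'I_d.+1 -> 'I_(N + N).+1}) : {poly K} :=
  \poly_(i < d.+1) ((nat_of_ord (a (inord i)))%:Z - N%:Z)%:~R.
have /choice[rs Hrs] a : exists rs : seq K, P a != 0 -> forall x, root (P a) x -> x \in rs.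
  have [->|/roots_finite[rs Hrs]] := eqVneq (P a) 0; first by exists [::].
  by exists rs.
exists (flatten [seq rs a | a : {ffun 'I_d.+1 -> 'I_(N + N).+1}]) => x Ix Yx.
have /choice[c cE] := integral_reg_poly Ix.
have cN i : (`|c i| <= N)%N.
  have [zs [E szs Hz]] := reg_poly_split C x.
  have : `|(\prod_(z <- zs) ('X - z%:P))`_i| <= (1 + Y%:R) ^+ size zs.
    by apply: norm_coef_prod_XsubC => // z /Hz[f <-]; apply: Yx.
  rewrite szs -E coef_map /= cE ratr_int -intr_norm -(natrD _ 1) -natrX -/N.
  by rewrite -[N%:R]/(N%:Z%:~R) ler_int; lia.
pose a : {ffun 'I_d.+1 -> 'I_(N + N).+1} := [ffun i : 'I_d.+1 => inord `|(c i + N%:Z)%R|%N].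
have PE : P a = map_poly (in_alg K) (reg_poly x).
  apply/polyP => i; rewrite coef_poly coef_map; case: ltnP => [ltid|leid].
    rewrite cE /= scaler_int /a ffunE; congr (_%:~R).
    by rewrite !inordK //; have := cN i; lia.
  by rewrite [X in _ = in_alg K X]nth_default ?size_reg_poly //= scale0r.
apply/flattenP; exists (rs a); first by apply: map_f; rewrite mem_enum.
apply: Hrs; rewrite PE; last exact: root_reg_poly_in.
by rewrite monic_neq0 // monic_map // reg_poly_monic.
Qed.

(** The norm [M] of [y] is a nonzero integer divisible by [y], and at least
    [1] in absolute value, which bounds [y] from below. *)
Lemma inverse_bounds (Y : nat) y : y != 0 -> integral y -> house_le Y y -> (0 < Y)%N ->
  exists M : nat, [/\ (0 < M <= Y ^ d)%N, integral (M%:R / y) & house_le (Y ^ d) y^-1].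
Proof.
move=> y0 Iy Yy Y0; have /choice[c cE] := integral_reg_poly Iy.
have [zs [E szs Hz]] := reg_poly_split C y.
have c0E : (c 0%N)%:~R = (-1) ^+ d * \prod_(z <- zs) z :> C.
  have := coef0_prod_XsubC zs; rewrite -E coef_map /= cE ratr_int szs => ->.
  by [].
have norm_c0 : (`|c 0%N|%N)%:R = \prod_(z <- zs) `|z| :> C.
  by rewrite natr_absz intr_norm c0E normrM normrX normrN1 expr1n mul1r normr_prod.
have zY z : z \in zs -> `|z| <= Y%:R by move=> /Hz[f <-]; apply: Yy.
have M0 : (0 < `|c 0%N|)%N.
  rewrite lt0n -(eqr_nat C) norm_c0 prodf_seq_neq0; apply/allP => z /Hz[f <-] /=.
  by rewrite normr_eq0 fmorph_eq0.
exists `|c 0%N|%N; split.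
- by rewrite M0 /= -(ler_nat C) norm_c0 natrX -szs prod_norm_le.
- have : integral ((c 0%N)%:~R / y).
    have := root_reg_poly_in y; rewrite rootE (horner_coef_wide _ (_ : _ <= d.+1)%N);
      last first.
      by rewrite size_map_poly size_reg_poly.
    rewrite big_ord_recl expr0 mulr1 coef_map cE /= scaler_int addr_eq0 => /eqP ->.
    rewrite mulNr mulr_suml; apply: integral_opp; apply: integral_sum => i _.
    rewrite coef_map cE /= scaler_int /bump /= exprSr mulrA mulfK //.
    by apply: integral_mul; [apply: integral_int|apply: integral_exp].
  have [->|->] : (`|c 0%N|%N)%:R = (c 0%N)%:~R :> K \/ (`|c 0%N|%N)%:R = - (c 0%N)%:~R :> K.
    by case: (c 0%N) => n; [left|right; rewrite NegzE mulrNz opprK].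
  + by [].
  + by rewrite mulNr; apply: integral_opp.
- move=> f; rewrite fmorphV normfV -[leLHS]mul1r ler_pdivrMr ?normr_gt0 ?fmorph_eq0 //.
  have fz : f y \in zs by rewrite -root_prod_XsubC -E root_reg_poly.
  apply: (@le_trans _ _ (`|c 0%N|%N)%:R); first by rewrite ler1n.
  rewrite norm_c0 (perm_big _ (perm_to_rem fz)) big_cons [leRHS]mulrC;
    apply: ler_wpM2l => //.
  apply: (@le_trans _ _ (Y%:R ^+ size (rem (f y) zs))).
    by apply: prod_norm_le => z /mem_rem; apply: zY.
  rewrite natrX ler_weXn2l ?ler1n // size_rem // szs leq_pred //.
Qed.
End FieldIntegers.

(** * Diagonalization in a complex embedding *)

Section Diagonalized.
Variables (K : fieldExtType rat) (C : numClosedFieldType) (n : nat).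
Implicit Types (A B : 'M[K]_n.+1) (P : 'M[C]_n.+1) (f : {rmorphism K -> C}).

(** Diagonalization in a prescribed basis of eigenvectors, the rows of [P], so
    that one [P] can serve several commuting matrices. *)
Definition diag_by f P A (l : 'I_n.+1 -> C) :=
  P *m map_mx f A = diag_mx (\row_a l a) *m P.

Lemma diag_by_ext f P A l m : l =1 m -> diag_by f P A l -> diag_by f P A m.
Proof. by move=> lm; rewrite /diag_by (_ : \row_a l a = \row_a m a) //; apply/rowP => a;
  rewrite !mxE lm. Qed.

Lemma diag_by1 f P : diag_by f P 1 (fun=> 1).
Proof.
rewrite /diag_by map_mx1 mulmx1 (_ : diag_mx _ = 1%:M) ?mul1mx //.
by apply/matrixP => a b; rewrite !mxE.
Qed.

Lemma diag_byM f P A B l m : diag_by f P A l -> diag_by f P B m ->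
  diag_by f P (A * B) (fun a => l a * m a).
Proof.
rewrite /diag_by => PA PB; rewrite map_mxM mulmxA PA -mulmxA PB mulmxA mulmx_diag.
by congr (diag_mx _ *m _); apply/rowP => a; rewrite !mxE.
Qed.

Lemma diag_by_prod f P s (A : 'I_s -> 'M[K]_n.+1) l :
  (forall i, diag_by f P (A i) (l i)) ->
  diag_by f P (\prod_(i < s) A i) (fun a => \prod_(i < s) l i a).
Proof.
move=> PA; apply: (diag_by_ext (l := \big[(fun g h => fun a =>
  g a * h a)/(fun=> 1)]_(i < s) l i)).
  by move=> a; apply: (big_morph (fun g : 'I_n.+1 -> C => g a)).
by apply: (big_ind2 (diag_by f P)) => //; [apply: diag_by1|move=> *; apply: diag_byM].
Qed.

Lemma diag_by_char_poly f P A l : P \in unitmx -> diag_by f P A l ->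
  map_poly f (char_poly A) = \prod_(x <- [seq l a | a : 'I_n.+1]) ('X - x%:P).
Proof.
move=> uP PA; rewrite map_char_poly big_map big_enum /=.
have -> : \prod_a ('X - (l a)%:P) = char_poly (diag_mx (\row_a l a)).
  rewrite char_poly_trig ?diag_mx_is_trig //.
  by apply: eq_bigr => a _; rewrite !mxE eqxx.
rewrite /char_poly; apply: (@mulfI _ (\det (map_mx polyC P))).
  by rewrite det_map_mx polyC_eq0 -unitfE -unitmxE.
rewrite [RHS]mulrC -!det_mulmx; congr (\det _).
rewrite /char_poly_mx mulmxBr mulmxBl -!map_mxM PA.
by congr (_ - _); apply: scalar_mxC.
Qed.

Lemma diag_by_eq1 f P A : P \in unitmx -> diag_by f P A (fun=> 1) -> A = 1.
Proof.
rewrite /diag_by => uP; rewrite (_ : diag_mx _ = 1%:M); last by apply/matrixP => a b;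
  rewrite !mxE.
rewrite mul1mx => PA; apply: (map_mx_inj (f := f)).
by rewrite map_mx1 -(mulKmx uP (map_mx f A)) PA mulVmx.
Qed.

Lemma diag_by_eigen_neq0 f P A l : P \in unitmx -> diag_by f P A l -> A \in unitmx ->
  forall a, l a != 0.
Proof.
move=> uP PA uA a.
have : diag_mx (\row_a l a) \in unitmx.
  have -> : diag_mx (\row_a l a) = P *m map_mx f A *m invmx P by rewrite PA mulmxK.
  by rewrite !unitmx_mul uP map_unitmx uA unitmx_inv uP.
rewrite unitmxE det_diag unitfE prodf_seq_neq0 => /allP/(_ a).
by rewrite mxE; apply; rewrite mem_index_enum.
Qed.

Lemma diag_byV f P A l : P \in unitmx -> diag_by f P A l -> A \in unitmx ->
  diag_by f P A^-1 (fun a => (l a)^-1).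
Proof.
move=> uP PA uA; have l0 := diag_by_eigen_neq0 uP PA uA.
have lK : diag_mx (\row_a (l a)^-1) *m diag_mx (\row_a l a) = 1%:M.
  rewrite mulmx_diag; apply/matrixP => a b; rewrite !mxE; congr (_ *+ _).
  exact: mulVf.
rewrite /diag_by; have uA' : map_mx f A \in unitmx by rewrite map_unitmx.
have -> : map_mx f A^-1 = invmx (map_mx f A) by rewrite -map_invmx.
apply: (canLR (mulmxK uA')).
by rewrite -mulmxA PA mulmxA lK mul1mx.
Qed.

Lemma diag_by_exp f P A l m : diag_by f P A l -> diag_by f P (A ^+ m) (fun a => l a ^+ m).
Proof.
move=> PA; elim: m => [|m IHm]; first by apply: diag_by_ext (diag_by1 f P) => a;
  rewrite expr0.
by rewrite exprS; apply: diag_by_ext (diag_byM PA IHm) => a; rewrite exprS.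
Qed.

Lemma diag_by_expz f P A l (e : int) : P \in unitmx -> diag_by f P A l -> A \in unitmx ->
  diag_by f P (A ^ e) (fun a => l a ^ e).
Proof.
move=> uP PA uA; case: e => m; first exact: diag_by_exp.
exact: (diag_byV uP (diag_by_exp m.+1 PA) (unitrX m.+1 (uA : A \is a GRing.unit))).
Qed.

(** Diagonalizability over one algebraically closed field means that the
    minimal polynomial is separable, so it passes to any other one. *)
Lemma codiagonalization s (A : 'I_s -> 'M[K]_n.+1) f :
  (forall i j, A i *m A j = A j *m A i) -> (forall i, geom_diagonalizable (A i)) ->
  exists2 P, P \in unitmx & forall i, exists l, diag_by f P (A i) l.
Proof.
move=> Acomm Adiag.
have diagC i : diagonalizable (map_mx f (A i)).
  have [g /diagonalizableP[rs urs]] := Adiag i.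
  rewrite mxminpoly_map => dvd; apply/diagonalizableP; rewrite mxminpoly_map.
  have sep : separable_poly (map_poly f (mxminpoly (A i))).
    rewrite separable_map -(separable_map g); apply: dvdp_separable dvd _.
    by rewrite separable_prod_XsubC.
  have [zs zsE] := closed_field_poly_normal (map_poly f (mxminpoly (A i))).
  rewrite lead_coef_map (monicP (mxminpoly_monic _)) rmorph1 scale1r in zsE.
  by exists zs; rewrite ?zsE // -separable_prod_XsubC -zsE.
have /codiagonalizableP[P uP /allP AP] :
    {in [seq map_mx f (A i) | i : 'I_s] &, forall M N, comm_mx M N} /\
    (forall M, M \in [seq map_mx f (A i) | i : 'I_s] -> diagonalizable M).
  split=> [_ _ /mapP[i _ ->] /mapP[j _ ->]|_ /mapP[i _ ->] //].
  by rewrite /comm_mx -!map_mxM Acomm.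
exists P => // i; have /AP/similar_diagPex[D /(similarP uP) PD] :
  map_mx f (A i) \in [seq map_mx f (A i) | i : 'I_s].
  by apply: (map_f (fun i => map_mx f (A i))); rewrite mem_enum.
exists (fun a => D 0 a); rewrite /diag_by PD; congr (diag_mx _ *m _).
by apply/rowP => a; rewrite mxE.
Qed.

End Diagonalized.

Lemma integral_char_poly (F : fieldType) (n : nat) (A : 'M[F]_n) :
  (forall i j, integral (A i j)) -> forall k, integral (char_poly A)`_k.
Proof.
move=> IA; pose Ip (p : {poly F}) := forall k, integral p`_k.
have Ip1 : Ip 1 by move=> k; rewrite coef1; case: eqP => _;
  [apply: integral1|apply: integral0].
have IpM p q : Ip p -> Ip q -> Ip (p * q).
  by move=> Hp Hq k; rewrite coefM; apply: integral_sum => i _; apply: integral_mul.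
have IpN p : Ip p -> Ip (- p) by move=> Hp k; rewrite coefN; apply: integral_opp.
rewrite -/(Ip _) /char_poly; apply: (big_ind Ip).
- by move=> k; rewrite coef0; apply: integral0.
- by move=> p q Hp Hq k; rewrite coefD; apply: integral_add.
move=> s _; apply: (IpM); first by elim: (nat_of_bool _) => [|m IHm] //; rewrite exprS;
  apply: (IpM) => //; apply: (IpN).
apply: (big_ind Ip) => // i _ k; rewrite !mxE coefB coefC coefMn coefX.
apply: integral_sub; last by case: eqP => _; [apply: IA|apply: integral0].
by rewrite -mulrnA; apply: integral_nat.
Qed.

(** * Bounds for the eigenvalues of a matrix of bounded entries *)

Section Tame.
Variables (K : fieldExtType rat) (C : numClosedFieldType) (n : nat).
Local Notation d := (dim K).
Implicit Types (A B : 'M[K]_n.+1) (P : 'M[C]_n.+1) (f : {rmorphism K -> C}).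

Lemma diag_by_row f P A l a : diag_by f P A l -> row a P *m map_mx f A = l a *: row a P.
Proof.
move=> PA; rewrite -row_mul PA mul_diag_mx.
by apply/rowP => b; rewrite !mxE.
Qed.

Lemma diag_by_inj f P A l m : P \in unitmx -> diag_by f P A l -> diag_by f P A m -> l =1 m.
Proof.
move=> uP; rewrite /diag_by => -> E a.
have /(congr1 (mulmxr (invmx P))) := E; rewrite /= !mulmxK //.
by move=> /matrixP/(_ a a); rewrite !mxE eqxx.
Qed.

Lemma row_unit_neq0 P a : P \in unitmx -> row a P != 0.
Proof.
move=> uP; apply/eqP => /(congr1 (mulmxr (invmx P))) /=.
rewrite -row_mul mulmxV // mul0mx => /rowP/(_ a)/eqP.
by rewrite !mxE eqxx oner_eq0.
Qed.

Section Entries.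
Variables (A : 'M[K]_n.+1) (D Y : nat).
Hypothesis DA : forall i j, integral (D%:R * A i j).
Hypothesis YA : forall i j, house_le C Y (A i j).

Lemma eigenvalue_integral f P l a : P \in unitmx -> diag_by f P A l ->
  integral (D%:R * l a).
Proof.
move=> uP PA; pose M := map_mx f (D%:R *: A).
apply: (@integral_monic_root _ (char_poly M)); first exact: char_poly_monic.
  by apply: integral_char_poly => i j; rewrite !mxE; apply/integral_fmorph.
rewrite -eigenvalue_root_char; apply/eigenvalueP; exists (row a P);
  last exact: row_unit_neq0.
by rewrite /M map_mxZ rmorph_nat -scalemxAr (diag_by_row _ PA) scalerA.
Qed.

(** Summing the eigenvector equation over the entries compares [`|l a| * S] with
    [n.+1 * Y * S], where [S > 0] is the sum of the absolute values of the
    entries of the eigenvector. *)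
Lemma eigenvalue_bound f P l a : P \in unitmx -> diag_by f P A l -> `|l a| <= (n.+1 * Y)%:R.
Proof.
move=> uP PA; pose S := \sum_b `|P a b|.
have S0 : 0 < S.
  rewrite lt_def sumr_ge0 // andbT; apply: contraNneq (row_unit_neq0 a uP) => SE.
  apply/eqP/rowP => b; rewrite !mxE; apply/eqP; rewrite -normr_eq0; apply/eqP.
  by apply: (psumr_eq0P _ SE).
rewrite -(ler_pM2r S0) mulr_sumr.
have -> : (n.+1 * Y)%:R * S = \sum_(b < n.+1) \sum_c `|P a c| * Y%:R.
  by rewrite sumr_const card_ord -mulr_suml -/S natrM -mulr_natl; ring.
apply: ler_sum => b _; rewrite -normrM.
have /rowP/(_ b) := diag_by_row a PA; rewrite !mxE => <-.
apply: le_trans (ler_norm_sum _ _ _) _; apply: ler_sum => c _.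
by rewrite !mxE normrM ler_wpM2l // YA.
Qed.

(** Here [n.+1 * Y * Y] bounds the eigenvalues of [D A], its power [n.+1] the
    determinant of [D A] in every embedding, and the power [d] of the latter
    the norm of this determinant. *)
Definition tame_bound := (n.+1 * Y * ((n.+1 * Y * Y) ^ n.+1) ^ d.+1)%N.

End Entries.

(** An elementary substitute for a bound on the heights of the eigenvalues:
    it is invariant under inversion, and the bound [Z] gets multiplied when
    commuting matrices are. *)
Definition tame (Z : nat) A := exists2 E : nat, (0 < E <= Z)%N &
  forall f P l, P \in unitmx -> diag_by f P A l -> forall a,
    [/\ integral (E%:R * l a), integral (E%:R * (l a)^-1),
        `|l a| <= Z%:R & `|(l a)^-1| <= Z%:R].

Lemma diag_by_det f P A l : P \in unitmx -> diag_by f P A l -> f (\det A) = \prod_a l a.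
Proof.
move=> uP PA; rewrite -det_map_mx; apply: (@mulfI _ (\det P)).
  by rewrite -unitfE -unitmxE.
rewrite -det_mulmx PA det_mulmx mulrC det_diag.
by congr (_ * _); apply: eq_bigr => a _; rewrite mxE.
Qed.

(** The inverse of an eigenvalue of [D A] is the product of the others over
    [det (D A)], whose inverse is controlled by [inverse_bounds]. *)
Lemma tame_of_entries A (D Y : nat) : (0 < D)%N -> (D <= Y)%N ->
  (forall i j, integral (D%:R * A i j)) -> (forall i j, house_le C Y (A i j)) ->
  A \in unitmx -> (forall f, exists2 P, P \in unitmx & exists l, diag_by f P A l) ->
  tame (tame_bound Y) A.
Proof.
move=> D0 DY DA YA uA diagA.
have Y0 : (0 < Y)%N by apply: leq_trans DY.
pose y := \det (D%:R *: A); set Y1 := ((n.+1 * Y * Y) ^ n.+1)%N.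
have NYY0 : (0 < n.+1 * Y * Y)%N by rewrite !muln_gt0 Y0.
have Y10 : (0 < Y1)%N by rewrite expn_gt0 NYY0.
have fyE f P l : P \in unitmx -> diag_by f P A l -> f y = \prod_a (D%:R * l a).
  move=> uP PA; rewrite /y detZ rmorphM rmorphXn rmorph_nat (diag_by_det uP PA).
  by rewrite big_split prodr_const card_ord.
have Dl f P l a : P \in unitmx -> diag_by f P A l -> `|D%:R * l a| <= (n.+1 * Y * Y)%:R.
  move=> uP PA; rewrite normrM normr_nat mulnC natrM ler_pM ?ler_nat //.
  exact: (eigenvalue_bound YA a uP PA).
have y0 : y != 0.
  rewrite /y detZ mulf_neq0 // ?expf_neq0 ?natr_eq0K -?lt0n //.
  by rewrite -unitfE -unitmxE.
have Iy : integral y.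
  have [f _] := embedding_exists K C; have [P uP [l PA]] := diagA f.
  apply/(integral_fmorph f); rewrite (fyE _ _ _ uP PA); apply: integral_prod => a _.
  exact: (eigenvalue_integral DA a uP PA).
have Yy : house_le C Y1 y.
  move=> f; have [P uP [l PA]] := diagA f; rewrite (fyE _ _ _ uP PA) normr_prod natrX.
  rewrite -[X in _ ^+ X]card_ord -prodr_const; apply: ler_prod => a _.
  by rewrite normr_ge0 (Dl _ _ _ _ uP PA).
have [M [/andP[M0 MY] IMy Yy']] := inverse_bounds y0 Iy Yy Y10.
have Y1d0 : (0 < Y1 ^ d)%N by rewrite expn_gt0 Y10.
have boundE : tame_bound Y = (n.+1 * Y * (Y1 * Y1 ^ d))%N by rewrite -expnS.
exists (D * M)%N.
  rewrite muln_gt0 D0 M0 boundE leq_mul //; first by rewrite (leq_trans DY) ?leq_pmull.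
  by rewrite (leq_trans MY) // leq_pmull.
move=> f P l uP PA a.
have la0 := diag_by_eigen_neq0 uP PA uA a.
have fy0 : f y != 0 by rewrite fmorph_eq0.
pose rest := \prod_(b | b != a) (D%:R * l b).
have lV : (l a)^-1 = D%:R * rest / f y.
  apply: (mulIf fy0); rewrite divfK // (fyE _ _ _ uP PA) (bigD1 a) //= -/rest.
  by field.
have IDl b : integral (D%:R * l b) by apply: (eigenvalue_integral DA b uP PA).
have Irest : integral rest by apply: integral_prod.
split.
- by rewrite natrM mulrAC; apply: integral_mul; [apply: IDl|apply: integral_nat].
- have -> : (D * M)%:R * (l a)^-1 = D%:R * D%:R * rest * f (M%:R / y).
    by rewrite lV natrM fmorph_div rmorph_nat; ring.
  apply: integral_mul; last exact/integral_fmorph.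
  by do !apply: integral_mul => //; apply: integral_nat.
- apply: le_trans (eigenvalue_bound YA a uP PA) _.
  by rewrite ler_nat boundE leq_pmulr // muln_gt0 Y10.
- rewrite lV normrM normrM normr_nat -fmorphV.
  have restY : `|rest| <= Y1%:R.
    rewrite /rest normr_prod; apply: (@le_trans _ _ (\prod_(b :
      'I_n.+1 | b != a) (n.+1 * Y * Y)%:R)).
      by apply: ler_prod => b _; rewrite normr_ge0 (Dl _ _ _ _ uP PA).
    by rewrite prodr_const natrX ler_weXn2l ?ler1n // -[X in (_ <= X)%N]card_ord max_card.
  rewrite boundE mulnA [X in _ <= X]natrM [X in _ <= X * _]natrM.
  apply: ler_pM => //; [by rewrite mulr_ge0| |exact: Yy'].
  by apply: ler_pM => //; rewrite ler_nat (leq_trans DY) // leq_pmull.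
Qed.

Lemma tame_monomial s (A : 'I_s -> 'M[K]_n.+1) (Z : nat) f P l (e : 'I_s -> int) :
  (forall i, tame Z (A i)) -> P \in unitmx -> (forall i, diag_by f P (A i) (l i)) ->
  exists E : nat, [/\ (0 < E)%N, (E <= Z ^ (\sum_i `|e i|))%N &
    forall a, integral (E%:R * \prod_i l i a ^ e i) /\
              `|\prod_i l i a ^ e i| <= (Z ^ (\sum_i `|e i|))%:R].
Proof.
move=> tameA uP PA.
have /choice[E HE] i : exists E : nat, (0 < E <= Z)%N /\ forall a,
    [/\ integral (E%:R * l i a), integral (E%:R * (l i a)^-1),
        `|l i a| <= Z%:R & `|(l i a)^-1| <= Z%:R].
  by have [E E0 HE] := tameA i; exists E; split=> // a; apply: (HE f P (l i) uP (PA i)).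
exists (\prod_i E i ^ `|e i|)%N; split.
- by apply: prodn_gt0 => i; rewrite expn_gt0; have [/andP[->]] := HE i.
- rewrite expn_sum; apply: leq_prod => i _.
  have [/andP[_ EZ] _] := HE i; by case: `|e i|%N => // k; rewrite leq_exp2r.
move=> a; split.
  rewrite natr_prod -big_split; apply: integral_prod => i _ /=.
  have [_ /(_ a)[I1 I2 _ _]] := HE i.
  rewrite natrX; case: (e i) => k.
    by rewrite -exprMn; apply: integral_exp.
  by rewrite NegzE -invr_expz -exprVn -exprMn abszN; apply: integral_exp.
rewrite normr_prod expn_sum natr_prod; apply: ler_prod => i _.
have [_ /(_ a)[_ _ H1 H2]] := HE i; rewrite normr_ge0 natrX /=.
case: (e i) => k; first by rewrite normrX lerXn2r ?nnegrE.
by rewrite NegzE -invr_expz -exprVn normrX abszN lerXn2r ?nnegrE.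
Qed.

End Tame.

(** * Eigenvalues of small height *)

Section Torsion.
Variables (K : fieldExtType rat) (C : numClosedFieldType) (n : nat).
Local Notation d := (dim K).
Implicit Types (A B : 'M[K]_n.+1) (P : 'M[C]_n.+1) (f : {rmorphism K -> C}).

Lemma northcott_eigenvalues f (Y : nat) : exists S : seq C, forall B,
  (forall i, integral (char_poly B)`_i) -> (forall i, house_le C Y (char_poly B)`_i) ->
  forall x, root (map_poly f (char_poly B)) x -> x \in S.
Proof.
have [S HS] := northcott K C Y.
pose q (a : {ffun 'I_n.+2 -> 'I_(size S).+1}) : {poly K} :=
  \poly_(i < n.+2) S`_(a (inord i)).
have /choice[rs Hrs] a : exists rs : seq C, q a != 0 ->
  forall x, root (map_poly f (q a)) x -> x \in rs.
  have [->|q0] := eqVneq (q a) 0; first by exists [::].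
  have [|rs Hrs] := @roots_finite _ (map_poly f (q a)); first by rewrite map_poly_eq0.
  by exists rs.
exists (flatten [seq rs a | a : {ffun 'I_n.+2 -> 'I_(size S).+1}]) => B IB YB x Bx.
pose a : {ffun 'I_n.+2 -> 'I_(size S).+1} := [ffun i :
  'I_n.+2 => inord (index (char_poly B)`_i S)].
have qE : q a = char_poly B.
  apply/polyP => i; rewrite coef_poly; case: ltnP => [lti|lei]; last first.
    by rewrite nth_default // size_char_poly.
  rewrite /a ffunE !inordK ?ltnS ?index_size // nth_index //.
  by apply: HS; [apply: IB|apply: YB].
apply/flattenP; exists (rs a); first by apply: map_f; rewrite mem_enum.
by apply: Hrs; rewrite qE // monic_neq0 // char_poly_monic.
Qed.

(** Two of the powers [x ^+ t] with [t <= T] coincide. *)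
Lemma power_torsion (S : seq C) (x : C) (T : nat) : x != 0 -> (size S <= T)%N ->
  (forall t, (t <= T)%N -> x ^+ t \in S) -> x ^+ T`! = 1.
Proof.
move=> x0 ST xS; pose r := [seq x ^+ t | t <- iota 0 T.+1].
have : ~~ uniq r.
  apply: contraL ST => /uniq_leq_size leS; rewrite -ltnNge.
  suff : (size r <= size S)%N by rewrite size_map size_iota.
  by apply: leS => _ /mapP[t + ->]; rewrite mem_iota add0n ltnS => /xS.
move=> /(uniqPn 0)[i [j [ij]]]; rewrite size_map size_iota => jT.
have iT := ltn_trans ij jT.
rewrite !(nth_map 0%N) ?size_iota // !nth_iota // !add0n => xij.
have xE : x ^+ (j - i) = 1.
  by apply: (mulfI (expf_neq0 i x0)); rewrite -exprD subnKC ?mulr1 // ltnW.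
have /dvdnP[k ->] : (j - i %| T`!)%N.
  by apply: dvdn_fact; rewrite subn_gt0 ij (leq_trans (leq_subr _ _)) // -ltnS.
by rewrite mulnC exprM xE expr1n.
Qed.

(* Comparison of [Q]-th powers. *)
Lemma exp_small (Z Q L W w k : nat) : (0 < Z)%N -> (0 < Q)%N -> (0 < k)%N ->
  (Z ^ W < 2 ^ Q)%N ->
  (L * Q * w <= W * k)%N -> (Z ^ (L * w) < 2 ^ k)%N.
Proof.
move=> Z0 Q0 k0 ZW LW; rewrite -(ltn_exp2r _ _ Q0) -!expnM [(k * Q)%N]mulnC [(2 ^ (Q * k))%N]expnM.
apply: (@leq_ltn_trans (Z ^ (W * k))); first by apply: leq_pexp2l => //; rewrite mulnAC.
by rewrite expnM ltn_exp2r.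
Qed.

(** If a power of [B] is a monomial in the [A_i] with exponents small relative
    to that power, then the heights of the eigenvalues of [B] are so small
    that these eigenvalues are integral, and their powers stay in a fixed
    finite set; hence they are roots of unity of bounded order. *)
Lemma torsion_of_small_exponents (s : nat) : exists N W : nat, (0 < N)%N /\
  forall (Z Q k : nat) (A : 'I_s -> 'M[K]_n.+1) (e p : 'I_s -> int),
    (0 < Z)%N -> (Z ^ W < 2 ^ Q)%N ->
    (forall i, A i \in unitmx) -> (forall i j, A i *m A j = A j *m A i) ->
    (forall i, geom_diagonalizable (A i)) -> (forall i, tame C Z (A i)) ->
    (0 < k)%N -> (forall i, (`|e i| * Q <= k)%N) ->
    (\prod_(i < s) A i ^ p i) ^+ k = \prod_(i < s) A i ^ e i ->
    (\prod_(i < s) A i ^ p i) ^+ N = 1.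
Proof.
have [f0 _] := embedding_exists K C.
have [S HS] := northcott_eigenvalues f0 (3 ^ n.+1).
(* The first summand of [W] is used for the integrality of the characteristic
   polynomial of [B], the second for the size of the powers up to [T]. *)
set T := size S; exists T`!, (s * (n.+1 * d) + s * T)%N; split; first exact: fact_gt0.
move=> Z Q k A e p Z0 ZQ uA Acomm Adiag tameA k0 eQ BE.
set B := \prod_(i < s) A i ^ p i in BE *.
set W := (_ + _)%N in ZQ.
have Q0 : (0 < Q)%N.
  by case: Q ZQ {eQ} => //; rewrite expn0 ltnS leqn0 expn_eq0 -leqn0 leqNgt Z0.
set L := (\sum_i `|e i|)%N.
have LQ : (L * Q <= s * k)%N.
  rewrite big_distrl /= -[X in (X * k)%N]card_ord -sum_nat_const.
  by apply: leq_sum => i _; apply: eQ.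
have LW w : (s * w <= W)%N -> (L * Q * w <= W * k)%N.
  move=> swW; apply: (@leq_trans (s * k * w)); first by rewrite leq_mul2r LQ orbT.
  by rewrite mulnAC leq_mul2r swW orbT.
have diagA f := codiagonalization f Acomm Adiag.
pose good f P (b : 'I_n.+1 -> C) (E : nat) := [/\ P \in unitmx, diag_by f P B b,
  (0 < E <= Z ^ L)%N, forall a, b a != 0 &
  forall a, integral (E%:R * b a ^+ k) /\ `|b a ^+ k| <= (Z ^ L)%:R].
have goodf f : exists P b E, good f P b E.
  have [P uP /choice[l PA]] := diagA f.
  have PXe (u : 'I_s -> int) : diag_by f P (\prod_(i < s) A i ^ u i) (fun a =>
    \prod_(i < s) l i a ^ u i).
    by apply: (diag_by_prod (l := fun i a => l i a ^ u i)) => i; apply: diag_by_expz.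
  have [E [E0 EZ HE]] := tame_monomial e tameA uP PA.
  exists P, (fun a => \prod_(i < s) l i a ^ p i), E; split=> //; first exact: PXe.
  - by rewrite E0.
  - move=> a; apply/prodf_neq0 => i _; apply: expfz_neq0.
    exact: (diag_by_eigen_neq0 uP (PA i) (uA i)).
  move=> a; have PBk := diag_by_exp k (PXe p); rewrite -/B BE in PBk.
  by rewrite (diag_by_inj uP PBk (PXe e) a).
have small f t P b E : good f P b E -> (t <= T)%N -> forall a, `|b a ^+ t| <= 2%:R.
  move=> [_ _ _ _ Hb] tT a; have [_ bZ] := Hb a.
  rewrite -(ler_pXn2r k0) ?nnegrE // -normrX -exprM mulnC exprM normrX.
  apply: (@le_trans _ _ ((Z ^ L)%:R ^+ t)); first by rewrite lerXn2r ?nnegrE.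
  rewrite -!natrX ler_nat -expnM ltnW // (exp_small Z0 Q0 k0 ZQ) // LW //.
  by rewrite (leq_trans _ (leq_addl _ _)) // leq_mul2l tT orbT.
have IB i : integral (char_poly B)`_i.
  have [P [b [E [uP PB /andP[E0 EZ] _ Hb]]]] := goodf f0.
  apply: (@integral_of_small_denominator _ C _ (E ^ n.+1) k).
  - by rewrite expn_gt0 E0.
  - rewrite -expnM; apply: (@leq_ltn_trans (Z ^ (L * (n.+1 * d)))).
      by rewrite [(Z ^ _)%N]expnM leq_exp2r ?muln_gt0 ?dim_field_gt0.
    apply: (exp_small Z0 Q0 k0 ZQ).
    by rewrite LW // leq_addr.
  - apply/(integral_fmorph f0); rewrite natrX rmorphM !rmorphXn rmorph_nat -coef_map.
    rewrite (diag_by_char_poly uP PB).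
    have szb : size [seq b a | a : 'I_n.+1] = n.+1 by rewrite size_map -cardE card_ord.
    rewrite -{1}szb; apply: integral_coef_exp => // _ /mapP[a _ ->].
    by have [] := Hb a.
have Ib f P b E : good f P b E -> forall a, integral (b a).
  move=> [uP PB _ _ _] a.
  apply: (@integral_monic_root _ (map_poly f (char_poly B))).
  - by rewrite monic_map // char_poly_monic.
  - by move=> i; rewrite coef_map; apply/integral_fmorph.
  - rewrite (diag_by_char_poly uP PB) root_prod_XsubC.
    by apply: map_f; rewrite mem_enum.
have [P [b [E gb]]] := goodf f0; have [uP PB _ b0 _] := gb.
apply: (@diag_by_eq1 _ _ _ f0 P) => //.
apply: diag_by_ext (diag_by_exp T`! PB) => a; apply: (@power_torsion S) => // t tT.
have coefE f P' b' E' : good f P' b' E' ->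
    map_poly f (char_poly (B ^+ t)) = \prod_(x <- [seq b' a ^+ t | a :
      'I_n.+1]) ('X - x%:P).
  by move=> [uP' PB' _ _ _]; apply: diag_by_char_poly uP' (diag_by_exp t PB').
apply: (HS (B ^+ t)).
- move=> i; apply/(integral_fmorph f0); rewrite -coef_map (coefE _ _ _ _ gb).
  apply: integral_prod_XsubC => _ /mapP[c _ ->]; apply: integral_exp.
  exact: (Ib _ _ _ _ gb).
- move=> i f; have [P' [b' [E' gb']]] := goodf f.
  rewrite -coef_map (coefE _ _ _ _ gb').
  have -> : (3 ^ n.+1)%:R = (1 + 2%:R) ^+ size [seq b' a ^+ t | a : 'I_n.+1] :> C.
    by rewrite size_map -cardE card_ord -(natrD _ 1) -natrX.
  by apply: norm_coef_prod_XsubC => // _ /mapP[c _ ->]; apply: (small _ _ _ _ _ gb').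
- rewrite (coefE _ _ _ _ gb) root_prod_XsubC.
  by apply: (map_f (fun a => b a ^+ t)); rewrite mem_enum.
Qed.
End Torsion.

(** * Small relations from approximate ones *)

Section SmallRelations.
Variable s : nat.
Implicit Types k p e : 'I_s.+1 -> int.

(** Dirichlet's simultaneous approximation of the ratios [k j / k m], by the
    box principle applied to the fractional parts of [t k j / k m]. *)
Lemma dirichlet k (m : 'I_s.+1) (Q : nat) : (0 < Q)%N -> 0 < k m ->
  exists p, [/\ 0 < p m, p m <= (Q ^ s)%N &
    forall j, `|p j * k m - p m * k j| * Q%:Z <= k m].
Proof.
case: Q => // Q _ km0.
pose r (t : nat) j := ((t%:Z * k j) %% k m)%Z.
have r_ge t j : 0 <= r t j by apply: modz_ge0; rewrite lt0r_neq0.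
have r_lt t j : r t j < k m by apply: ltz_pmod.
pose box t j := ((Q.+1%:Z * r t j) %/ k m)%Z.
have box_ge t j : 0 <= box t j by rewrite divz_ge0 // mulr_ge0.
have box_lt t j : box t j < Q.+1%:Z by rewrite ltz_divLR // ltr_pM2l // r_lt.
pose F (t : 'I_(Q.+1 ^ s).+1) : {ffun 'I_s -> 'I_Q.+1} :=
  [ffun j : 'I_s => inord `|box t (lift m j)|%N].
have : ~ injective F.
  move=> /leq_card; rewrite card_ffun !card_ord; lia.
move=> /existsNP[t] /existsNP[t'] /not_implyP[FF tt'].
wlog lt : t t' FF tt' / (t < t')%N.
  move=> H; have [lt|le|/val_inj//] := ssrnat.ltngtP t t'; first exact: (H t t').
  by apply: (H t' t) => // E; apply: tt'.
have rE (u : nat) j : u%:Z * k j = ((u%:Z * k j) %/ k m)%Z * k m + r u j by apply: divz_eq.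
pose p j := ((t'%:Z * k j) %/ k m)%Z - ((t%:Z * k j) %/ k m)%Z.
have pm : p m = t'%:Z - t%:Z by rewrite /p !mulzK // lt0r_neq0.
exists p; rewrite pm; split; first by lia.
  by have := ltn_ord t'; lia.
move=> j.
have -> : p j * k m - (t'%:Z - t%:Z) * k j = r t j - r t' j.
  by have := rE t j; have := rE t' j; rewrite /p; lia.
have boxE : box t j = box t' j.
  have [i ->|->] := unliftP m j.
    have /ffunP/(_ i) := FF; rewrite !ffunE => /(congr1 val) /=.
    have := box_ge t (lift m i); have := box_lt t (lift m i).
    have := box_ge t' (lift m i); have := box_lt t' (lift m i).
    by move=> h1 h2 h3 h4; rewrite !inordK; lia.
  have r0 (u : nat) : r u m = 0 by rewrite /r modzMl.
  by rewrite /box !r0.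
have bd u : box u j * k m <= Q.+1%:Z * r u j < (box u j + 1) * k m.
  have := divz_eq (Q.+1%:Z * r u j) (k m); rewrite -/(box u j) => E.
  have h1 := modz_ge0 (Q.+1%:Z * r u j) (lt0r_neq0 km0).
  have h2 := ltz_pmod (Q.+1%:Z * r u j) km0.
  by rewrite mulrDl mul1r; apply/andP; split; lia.
have := bd t; have := bd t'; rewrite -boxE mulrDl mul1r => /andP[b1 b2] /andP[b3 b4].
by case: (lerP 0 (r t j - r t' j)) => sg; rewrite ?(ger0_norm sg) ?(ltr0_norm sg); lia.
Qed.

(** Among the relations without zero entry take [k] of least maximum norm,
    with largest entry [k m].  If [k m] were large, subtracting from [k] a
    small multiple of the relation [N p], with [p] given by [dirichlet], would
    give a smaller one; one of [s + 2] consecutive multiples creates no zero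
    entry. *)
Lemma small_relation (L : ('I_s.+1 -> int) -> Prop) (N Q : nat) : (0 < N)%N -> (1 < Q)%N ->
  (forall k p (a : int), L k -> L p -> L (fun j => k j - a * p j)) ->
  (forall k p m, L k -> 0 < k m ->
    (forall j, `|p j * k m - p m * k j| * Q%:Z <= k m) -> L (fun j => N%:Z * p j)) ->
  (exists2 k, L k & forall j, k j != 0) ->
  exists k, [/\ L k, forall j, k j != 0 & forall j, (`|k j| <= s.+2 * N * Q ^ s)%N].
Proof.
move=> N0 Q1 LB LN [k0 Lk0 k00].
have exb : exists b, `[< exists k, [/\ L k, forall j, k j != 0 & forall j, (`|k j| <= b)%N] >].
  exists (\sum_j `|k0 j|)%N; apply/asboolP; exists k0; split=> // j.
  by rewrite (bigD1 j) //= leq_addr.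
have [b /asboolP[k [Lk kn0 kb]] minb] := ex_minnP exb.
exists k; split=> // j0; apply: leq_trans (kb j0) _; rewrite leqNgt; apply/negP => bbig.
have [m km] : exists m, `|k m|%N = b.
  apply: contrapT => /forallNP nob.
  have : (b <= b.-1)%N.
    apply: minb; apply/asboolP; exists k; split=> // j.
    have := kb j; have := nob j; lia.
  lia.
have {}[k' [Lk' k'n0 k'b k'm]] : exists k', [/\ L k', forall j, k' j != 0,
    forall j, (`|k' j| <= b)%N & k' m = b].
  have [km0|km0] := leP 0 (k m); first by exists k; split=> //; lia.
  exists (fun j => k j - 2 * k j); split.
  - exact: LB.
  - by move=> j; have := kn0 j; lia.
  - by move=> j; have := kb j; lia.
  - lia.
have b0 : (0 < b)%N by lia.
have k'm0 : 0 < k' m by rewrite k'm.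
have [p [pm0 pmQ pE]] := dirichlet (ltnW Q1) k'm0.
have LNp := LN k' p m Lk' k'm0 pE.
have [u hu] : exists u : 'I_s.+2, forall j, k' j - u.+1%:Z * (N%:Z * p j) != 0.
  apply: contrapT => /forallNP bad.
  have /choice[g Hg] (u : 'I_s.+2) : exists j, k' j - u.+1%:Z * (N%:Z * p j) = 0.
    have /existsNP[j /negP] := bad u; rewrite negbK => /eqP E; by exists j.
  have : ~ injective g by move=> /leq_card; rewrite !card_ord ltnn.
  move=> /existsNP[u] /existsNP[u'] /not_implyP[gg uu'].
  have := Hg u'; have := Hg u; rewrite -gg; set w := N%:Z * p _ => E1 E2.
  have /eqP : (u%:Z - u'%:Z) * w = 0 by lia.
  rewrite mulf_eq0 => /orP[/eqP uE|/eqP w0].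
    by apply: uu'; apply: val_inj => /=; lia.
  by have := k'n0 (g u); rewrite w0 in E1; lia.
set c := (u.+1 * N)%N.
have c0 : (0 < c)%N by rewrite muln_gt0.
have cb : c%:Z * p m < b%:Z.
  apply: (@le_lt_trans _ _ (s.+2 * N * Q ^ s)%N%:Z); last by [].
  rewrite [leRHS]PoszM; apply: ler_pM => //; first exact: ltW.
  by rewrite lez_nat /c leq_mul2r ltn_ord orbT.
have : (b <= b.-1)%N.
  apply: minb; apply/asboolP; exists (fun j => k' j - u.+1%:Z * (N%:Z * p j)); split=> //.
    exact: LB.
  move=> j; have e_small := pE j; set e := p j * k' m - p m * k' j in e_small.
  have eb : `|e| * 2 <= b%:Z.
    by apply: le_trans (_ : `|e| * Q%:Z <= _); [rewrite ler_wpM2l|rewrite -k'm].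
  set x := k' j - _.
  have xE : b%:Z * x = k' j * (b%:Z - c%:Z * p m) - c%:Z * e.
    by rewrite /x /e /c PoszM -k'm; ring.
  have x_small : b%:Z * `|x| <= b%:Z * (b%:Z - c%:Z * p m) + c%:Z * `|e|.
    have -> : b%:Z * `|x| = `|b%:Z * x| by rewrite normrM.
    rewrite xE; apply: le_trans (ler_normB _ _) _; rewrite !normrM; apply: lerD.
      rewrite (gtr0_norm (_ : 0 < b%:Z - c%:Z * p m)) ?subr_gt0 //.
      apply: ler_wpM2r; first by rewrite subr_ge0 ltW.
      by rewrite -abszE lez_nat k'b.
    by rewrite (ger0_norm (_ : 0 <= c%:Z)).
  have : b%:Z * `|x| < b%:Z * b%:Z.
    apply: (le_lt_trans x_small); move: eb pm0 c0 b0 => eb pm0 c0 b0.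
    have h1 : c%:Z * `|e| * 2 <= c%:Z * b%:Z by rewrite -mulrA ler_wpM2l.
    have h2 : c%:Z * b%:Z <= b%:Z * (c%:Z * p m).
      by rewrite mulrCA ler_wpM2l // ler_peMr //; lia.
    have h3 : 0 < c%:Z * b%:Z by rewrite mulr_gt0.
    rewrite mulrBr; lia.
  by rewrite ltr_pM2l // -abszE; lia.
lia.
Qed.

End SmallRelations.

(** * Monomials in commuting matrices *)

Lemma prod_expz_comb (F : fieldType) (I : finType) (l : I -> F) (u w : I ->
  int) (a b : int) :
  (forall i, l i != 0) ->
  \prod_i l i ^ (a * u i + b * w i) = (\prod_i l i ^ u i) ^ a * (\prod_i l i ^ w i) ^ b.
Proof.
move=> l0.
have prodX (e : I -> int) (c : int) : (\prod_i l i ^ e i) ^ c = \prod_i l i ^ (c * e i).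
  rewrite (big_morph (fun x => x ^ c) (fun x y => expfzMl x y c) (exp1rz _ c)).
  by apply: eq_bigr => i _; rewrite exprz_exp mulrC.
by rewrite !prodX -big_split; apply: eq_bigr => i _; rewrite expfzDr.
Qed.

Section Monomials.
Variables (K : fieldExtType rat) (C : numClosedFieldType) (n s : nat).
Variables (A : 'I_s -> 'M[K]_n.+1) (f : {rmorphism K -> C}).
Hypotheses (uA : forall i, A i \in unitmx) (Acomm : forall i j, A i *m A j = A j *m A i)
  (Adiag : forall i, geom_diagonalizable (A i)).

Definition monomial (k : 'I_s -> int) := \prod_(i < s) A i ^ k i.

Lemma diag_by_same (P : 'M[C]_n.+1) (B B' : 'M[K]_n.+1) l :
  P \in unitmx -> diag_by f P B l -> diag_by f P B' l -> B = B'.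
Proof.
move=> uP PB PB'; apply: (map_mx_inj (f := f)).
by rewrite -(mulKmx uP (map_mx f B)) PB -PB' mulKmx.
Qed.

(** Commuting diagonalizable matrices multiply like their joint eigenvalues. *)
Lemma monomial_eigenvalues : exists (P : 'M[C]_n.+1) l,
  [/\ P \in unitmx, forall i a, l i a != 0 &
  forall k, diag_by f P (monomial k) (fun a => \prod_(i < s) l i a ^ k i)].
Proof.
have [P uP /choice[l Hl]] := codiagonalization f Acomm Adiag.
exists P, l; split=> // [i a|k]; first exact: (diag_by_eigen_neq0 uP (Hl i) (uA i)).
by apply: (diag_by_prod (l := fun i a => l i a ^ k i)) => i; apply: diag_by_expz.
Qed.

Lemma monomial_comb k p (a b : int) : monomial k = 1 ->
  monomial (fun i => a * k i + b * p i) = monomial (fun i => b * p i).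
Proof.
have [P [l [uP l0 Pl]]] := monomial_eigenvalues => k1.
apply: (diag_by_same uP (Pl _)); apply: diag_by_ext (Pl _) => c.
have Pk := Pl k; rewrite k1 in Pk.
rewrite prod_expz_comb // (diag_by_inj uP Pk (diag_by1 f P) c) exp1rz mul1r.
have := prod_expz_comb (fun=> 0) p 0 b (l0^~ c); rewrite expr0z mul1r => <-.
by apply: eq_bigr => i _; rewrite mul0r add0r.
Qed.

Lemma monomial_exp p (N : nat) : monomial p ^+ N = monomial (fun j => N%:Z * p j).
Proof.
have [P [l [uP l0 Pl]]] := monomial_eigenvalues.
apply: (diag_by_same uP (diag_by_exp N (Pl p))); apply: diag_by_ext (Pl _) => c.
rewrite [RHS]exprnP; have := prod_expz_comb (fun=> 0) p 0 N%:Z (l0^~ c);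
  rewrite expr0z mul1r => <-.
by apply: eq_bigr => i _; rewrite mul0r add0r.
Qed.

End Monomials.

Section Assembly.
Variables (R : realType) (K : fieldExtType rat) (n : nat).
Local Notation d := (\dim {:K}).
Local Notation C := (R[i]).

Lemma normc_natr_le (z : C) (x : R) (Y : nat) : x <= Y%:R ->
  ComplexField.Normc.normc z <= x -> `|z| <= Y%:R.
Proof.
move=> xY zx; have -> : `|z| = real_complex R (ComplexField.Normc.normc z) by case: z {zx}.
rewrite -(rmorph_nat (real_complex R)) lecR.
exact: le_trans zx xY.
Qed.

Lemma tame_of_height (A : 'M[K]_n.+1) (Y : nat) : A \in unitmx ->
  (forall f : {rmorphism K -> C}, exists2 P, P \in unitmx & exists l, diag_by f P A l) ->
  mx_height R A ^+ d <= Y%:R -> tame C (tame_bound K n Y) A.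
Proof.
move=> uA diagA hY; set x := row_mx (1%:M : 'M_1) (mxvec A).
have xE i j : x 0 (rshift 1 (mxvec_index i j)) = A i j by rewrite row_mxEr mxvecE.
have x1 : x 0 (lshift _ 0) = 1 by rewrite row_mxEl mxE.
have [D [D0 DX ID]] := weil_height_denominator R x1.
apply: (@tame_of_entries _ _ _ _ D) => //.
- by rewrite -(ler_nat R); apply: le_trans DX hY.
- by move=> i j; rewrite -xE; apply: ID.
- by move=> i j f; rewrite -xE; apply: (normc_natr_le hY); apply: (weil_height_norm x1).
Qed.

Lemma mx_height_ge1 (A : 'M[K]_n.+1) : 1 <= mx_height R A ^+ d.
Proof. by apply: (@weil_height_ge1 _ _ _ _ (lshift _ 0)); rewrite row_mxEl mxE. Qed.

Lemma tame_bound_le Y : (0 < Y)%N ->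
  (0 < tame_bound K n Y <= (n.+1 * Y) ^ (2 * (n.+1 * (dim K).+1)).+1)%N.
Proof.
move=> Y0; rewrite /tame_bound.
rewrite !(muln_gt0, expn_gt0) Y0 /= [((n.+1 * Y) ^ _.+1)%N]expnS leq_mul2l; apply/orP;
  right.
rewrite -expnM [((n.+1 * Y) ^ _)%N]expnM leq_exp2r ?muln_gt0 // expnS expn1.
by rewrite leq_mul2l leq_pmull ?orbT.
Qed.

(** As [tame_bound] is polynomial in [Y], and [Y] is of the order of
    [(c * H) ^+ d], a power of two exceeding [tame_bound ^ W] needs an exponent
    that is only linear in [ln H]. *)
Lemma log_bound (c : R) (W : nat) : 0 < c -> exists2 C1 : R, 0 < C1 &
  forall H : R, 2 <= H -> 1 <= (c * H) ^+ d -> exists Y Q : nat,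
  [/\ (c * H) ^+ d <= Y%:R, (0 < Y)%N, (1 < Q)%N, (tame_bound K n Y ^ W < 2 ^ Q)%N &
      Q%:R <= C1 * ln H].
Proof.
move=> c0; pose g := (W * (2 * (n.+1 * (dim K).+1)).+1)%N.
have ln2 : 0 < ln (2 : R) by rewrite ln_gt0 // ltr1n.
have [a0 a0E] : exists a0 : R, a0 = 2 * n.+1%:R * c ^+ d by exists (2 * n.+1%:R * c ^+ d).
have a00 : 0 < a0 by rewrite a0E !mulr_gt0 // exprn_gt0.
pose a := `|ln a0|.
have ga0 : 0 < 2 + g%:R * (a / ln 2 + d%:R).
  by rewrite ltr_pwDl // mulr_ge0 // addr_ge0 // divr_ge0 ?normr_ge0 // ltW.
exists ((2 + g%:R * (a / ln 2 + d%:R)) / ln 2); first by rewrite divr_gt0.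
move=> H H2 X1; set X := (c * H) ^+ d in X1 *.
have H0 : 0 < H by apply: lt_le_trans H2.
have X0 : 0 <= X by apply: le_trans X1.
have [Y [Y0 XY YX]] : exists Y : nat, [/\ (0 < Y)%N, X <= Y%:R & Y%:R <= 2 * X].
  have /andP[h1 /ltW h2] := truncn_itv X0; exists (Num.trunc X).+1; split=> //.
  by rewrite -addn1 natrD mulr_natl mulr2n lerD.
have /andP[Z0 ZY] := tame_bound_le Y0.
have [q [Zq qZ]] : exists q, (tame_bound K n Y ^ W < 2 ^ q.+1)%N /\ (2 ^ q <= tame_bound K n Y ^ W)%N.
  exists (trunc_log 2 (tame_bound K n Y ^ W)); split; first exact: trunc_log_ltn.
  by apply: trunc_logP; rewrite // expn_gt0 Z0.
exists Y, q.+2; split=> //; first by apply: leq_trans Zq _; rewrite leq_exp2l.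
have {}qZ : (2 ^ q <= (n.+1 * Y) ^ g)%N.
  apply: (leq_trans qZ).
  by rewrite /g [(W * _)%N]mulnC expnM; case: (W) => // w; rewrite leq_exp2r.
have qV : (2 : R) ^+ q <= (a0 * H ^+ d) ^+ g.
  apply: (@le_trans _ _ (((n.+1 * Y) ^ g)%N%:R)); first by rewrite -natrX ler_nat.
  rewrite natrX lerXn2r ?nnegrE //.
    by rewrite mulr_ge0 ?exprn_ge0 // ltW.
  have -> : a0 * H ^+ d = n.+1%:R * (2 * X).
    by rewrite a0E /X exprMn !mulrA [n.+1%:R * 2]mulrC.
  by rewrite natrM; apply: ler_wpM2l.
have {}qV : q%:R * ln 2 <= g%:R * (a + d%:R * ln H).
  have Hd0 : 0 < H ^+ d by rewrite exprn_gt0.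
  have : ln ((2 : R) ^+ q) <= ln ((a0 * H ^+ d) ^+ g).
    by rewrite ler_ln // posrE exprn_gt0 // mulr_gt0.
  have lnV : ln (a0 * H ^+ d) = ln a0 + d%:R * ln H by rewrite lnM ?posrE // lnXn //
    mulr_natl.
  have V0 : 0 < a0 * H ^+ d by rewrite mulr_gt0.
  have lnq : ln ((2 : R) ^+ q) = q%:R * ln 2 by rewrite (lnXn q (ltr0Sn R 1)) mulr_natl.
  have lng : ln ((a0 * H ^+ d) ^+ g) = g%:R * ln (a0 * H ^+ d)
    by rewrite (lnXn g V0) mulr_natl.
  rewrite lnq lng lnV => h; apply: (le_trans h); rewrite ler_wpM2l // lerD2r.
  exact: ler_norm.
have lnH : ln 2 <= ln H by rewrite ler_ln // posrE.
set t := ln H / ln 2; have t1 : 1 <= t by rewrite ler_pdivlMr // mul1r.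
have -> : (2 + g%:R * (a / ln 2 + d%:R)) / ln 2 * ln H = 2 * t + g%:R * (a / ln 2 * t + d%:R * t).
  by rewrite /t; field; rewrite gt_eqF.
rewrite -addn2 natrD [q%:R + _]addrC; apply: lerD; first by rewrite ler_peMr.
rewrite -(ler_pM2r ln2); apply: (le_trans qV).
rewrite -(mulrA g%:R); apply: ler_wpM2l => //; rewrite mulrDl; apply: lerD.
  by rewrite mulrAC divfK ?gt_eqF // ler_peMr // normr_ge0.
by rewrite -mulrA divfK ?gt_eqF.
Qed.

End Assembly.

(** * Small multiplicative relations *)

Theorem theorem5 (R : realType) (K : fieldExtType rat) (n s : nat) (c : R)
    (hs : (2 <= s)%N) (hc : 0 < c) :
  exists2 C : R, 0 < C &
    forall (H : R) (A : 'I_s -> 'M[K]_n.+1),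
      2 <= H ->
      (forall i, A i \in unitmx) ->
      (forall i j, A i *m A j = A j *m A i) ->
      (forall i, geom_diagonalizable (A i)) ->
      (forall i, mx_height R (A i) <= c * H) ->
      (exists k : 'I_s -> int,
         \prod_(i < s) k i != 0 /\ \prod_(i < s) A i ^ k i = 1%:M) ->
      exists (r : nat) (k : 'I_s -> int),
        [/\ (0 < r < s)%N,
            \prod_(i < s) k i != 0,
            forall i, `|k i|%:~R <= C * ln H ^+ r &
            \prod_(i < s) A i ^ k i = 1%:M].
Proof.
case: s hs => // s hs.
have [N [W [N0 torsion]]] := torsion_of_small_exponents K (R[i] :
  numClosedFieldType) n s.+1.
have [C1 C10 HC1] := log_bound K n W hc.
exists ((s.+2 * N)%:R * C1 ^+ s).
  by rewrite mulr_gt0 ?ltr0n ?muln_gt0 // exprn_gt0.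
move=> H A H2 uA Acomm Adiag hA [k0 [k00 Ak0]].
have [f _] := embedding_exists K (R[i] : numClosedFieldType).
have heightA i : mx_height R (A i) ^+ \dim {:K} <= (c * H) ^+ \dim {:K}.
  by rewrite lerXn2r ?nnegrE ?powR_ge0 // (le_trans _ (hA i)) // powR_ge0.
have X1 : 1 <= (c * H) ^+ \dim {:K} := le_trans (mx_height_ge1 R (A ord0)) (heightA ord0).
have [Y [Q [XY Y0 Q1 ZQ QH]]] := HC1 H H2 X1.
have /andP[Z0 _] := tame_bound_le K n Y0.
have tameA i : tame R[i] (tame_bound K n Y) (A i).
  apply: tame_of_height (uA i) _ (le_trans (heightA i) XY) => g.
  by have [P uP HP] := codiagonalization g Acomm Adiag; exists P.
have [|||k [Ak kn0 kQ]] := @small_relation s (fun k => monomial A k = 1) N Q N0 Q1.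
- move=> k p a Ak Ap; have := monomial_comb f uA Acomm Adiag p 1 (- a) Ak.
  have := monomial_comb f uA Acomm Adiag (fun=> 0) (- a) 0 Ap.
  have mono_ext u w : u =1 w -> monomial A u = monomial A w.
    by move=> uw; apply: eq_bigr => i _; rewrite uw.
  rewrite (mono_ext _ (fun i => - a * p i)) => [->|i]; last by rewrite mul0r addr0.
  rewrite (mono_ext _ (fun i => k i - a * p i)) => [->|i]; last by rewrite mul1r mulNr.
  by apply: big1 => i _; rewrite mulr0 expr0z.
- move=> k p m Ak km0 small; rewrite -(monomial_exp f uA Acomm Adiag).
  apply: (torsion _ Q `|k m|%N A (fun j => k m * p j - p m * k j) p Z0 ZQ) => //.
  + by rewrite absz_gt0 gt_eqF.
  + move=> j; have := small j; rewrite [k m * _]mulrC; lia.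
  + rewrite -/(monomial A p) (monomial_exp f uA Acomm Adiag).
    have := monomial_comb f uA Acomm Adiag p (- p m) (k m) Ak.
    rewrite gtz0_abs // => <-; apply: eq_bigr => i _.
    by rewrite addrC mulNr.
- exists k0 => // j; apply: contraNneq k00 => kj.
  by rewrite (bigD1 j) //= kj mul0r.
exists s, k; split=> //.
- by rewrite -ltnS hs ltnSn.
- by apply/prodf_neq0.
- move=> i; rewrite -natr_absz -mulrA -exprMn.
  apply: (@le_trans _ _ ((s.+2 * N * Q ^ s)%N%:R)); first by rewrite ler_nat.
  rewrite natrM ler_wpM2l // natrX lerXn2r ?nnegrE // mulr_ge0 ?ln_ge0 ?ltW //.
  by rewrite (lt_le_trans _ H2) // ltr1n.
Qed.
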